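(* Let $T$ be a banded semi-infinite matrix with two superdiagonals and three subdiagonals, with $T_{n+3,n}T_{n,n+2}\ne0$ for all $n\in\mathbb N$. If $T$ is bounded and there exists $s\ge0$ such that $T+sI$ has a positive bidiagonal factorization, then the $2\times3$ matrices of Weyl functions $S^{[N]}$ converge, uniformly on compact subsets of $\bar{\mathbb C}\setminus\Delta$, to the matrix $\hat\psi$ of Stieltjes--Markov functions: $$\lim_{N\to\infty}S^{[N]}(z)=\lim_{N\to\infty}\frac{P^{(1)}_{N+1}(z)}{P_{N+1}(z)}=\hat\psi(z)\qquad\text{uniformly on compact subsets of }\bar{\mathbb C}\setminus\Delta .$$
   Context: $\mathbb N=\{0,1,2,\dots\}$, $\bar{\mathbb C}=\mathbb C\cup\{\infty\}$. $T=(T_{i,j})_{i,j\in\mathbb N}$ is a real semi-infinite matrix with $T_{i,j}=0$ unless $-3\le j-i\le2$; bounded means it defines a bounded operator. $T^{[N]}$ is the $(N+1)\times(N+1)$ leading principal submatrix, with indices $0,\dots,N$, and $P_{N+1}(x)=\det(xI_{N+1}-T^{[N]})$, $P_0=1$. Positive bidiagonal factorization (PBF): a real semi-infinite banded matrix $M=(M_{i,j})_{i,j\in\mathbb N}$ with $M_{i,j}=0$ unless $-3\le j-i\le2$ has a PBF if $M=L_1L_2L_3\,\Lambda\,U_2U_1$, where $\Lambda=\operatorname{diag}(\Lambda_0,\Lambda_1,\dots)$, each $L_k$ ($k=1,2,3$) is lower bidiagonal with ones on the diagonal and subdiagonal entries $L_{k|0},L_{k|1},\dots$, each $U_j$ ($j=1,2$)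 is upper bidiagonal with ones on the diagonal and superdiagonal entries $U_{j|0},U_{j|1},\dots$, and all $L_{k|i},U_{j|i},\Lambda_i$ ($i\in\mathbb N$) are positive. Fix arbitrary real constants $\nu^1_1,\nu^1_2,\nu^2_2,\xi^1_1$ and put $$\nu=\begin{bmatrix}1&0&0\\ \nu^1_1&1&0\\ \nu^1_2&\nu^2_2&1\end{bmatrix},\qquad \xi=\begin{bmatrix}1&0\\ \xi^1_1&1\end{bmatrix}.$$ $E_{[r]}$ denotes the matrix $[I_r\ \ 0]$ with $r$ rows and as many columns as needed (either $N+1$ or infinitely many); $\nu^{-\top}$ is the inverse transpose. Define $$P^{(1)}_{N+1}(z)=\xi^{-1}E_{[2]}\operatorname{adj}(zI_{N+1}-T^{[N]})E_{[3]}^\top\nu^{-\top},\qquad S^{[N]}(z)=\xi^{-1}E_{[2]}(zI_{N+1}-T^{[N]})^{-1}E_{[3]}^\top\nu^{-\top}=\frac{P^{(1)}_{N+1}(z)}{P_{N+1}(z)}$$ (for $N\ge2$). $\Delta$ is the compact interval that is the smallest closed interval containing all the (real) zeros of all the polynomials $P_{N+1}$, $N\in\mathbb N$. $\mathrm d\psi=[\mathrm d\psi_{b,a}]$ is the $2\times3$ matrix of finite Lebesgue--Stieltjes measures supported on $\Delta$ which is the spectral matrix of measures of $T$, i.e. $\int_\Delta x^n\,\mathrm d\psi(x)=\xi^{-1}E_{[2]}T^nE_{[3]}^\top\nu^{-\top}$ for all $n\in\mathbb N$, and $$\hat\psi(z)=\int_\Delta\frac{\mathrm d\psi(x)}{z-x}.$$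 *)

(* Defs.v *)
From HB Require Import structures.
From mathcomp Require Import all_boot all_order all_algebra complex.
From mathcomp Require Import all_classical all_reals all_analysis.
Import Order.TTheory GRing.Theory Num.Theory.
Import numFieldNormedType.Exports.

Set Implicit Arguments.
Unset Strict Implicit.
Unset Printing Implicit Defensive.

Local Open Scope classical_set_scope.
Local Open Scope ring_scope.

(** ** Semi-infinite matrices *)

Definition imatrix (R : Type) := nat -> nat -> R.

(* The sum is over the (finite) support of [k |-> A i k * B k j]: it is the
   usual product whenever A is row-finite or B is column-finite, as is the case
   for banded matrices. *)
Definition imulmx (R : realType) (A B : imatrix R) : imatrix R :=
  fun i j => \sum_(k \in [set: nat]) (A i k * B k j).

Definition iscalar_mx (R : realType) (s : R) : imatrix R :=
  fun i j => if i == j then s else 0.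

Definition iaddmx (R : realType) (A B : imatrix R) : imatrix R :=
  fun i j => A i j + B i j.

Definition iexpmx (R : realType) (A : imatrix R) (n : nat) : imatrix R :=
  iter n (imulmx A) (iscalar_mx 1).

Definition idiag_mx (R : realType) (d : nat -> R) : imatrix R :=
  fun i j => if i == j then d i else 0.

Definition lower_bidiag (R : realType) (l : nat -> R) : imatrix R :=
  fun i j => if i == j then 1 else if i == j.+1 then l j else 0.

Definition upper_bidiag (R : realType) (u : nat -> R) : imatrix R :=
  fun i j => if i == j then 1 else if j == i.+1 then u i else 0.

(* [A i j = 0] unless [-3 <= j - i <= 2]. *)
Definition banded (R : realType) (A : imatrix R) : Prop :=
  forall i j : nat, ~~ ((i <= j + 3) && (j <= i + 2))%N -> A i j = 0.

Definition has_PBF (R : realType) (A : imatrix R) : Prop :=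
  banded A /\
  exists L1 L2 L3 D U2 U1 : nat -> R,
    (forall i, [/\ 0 < L1 i, 0 < L2 i & 0 < L3 i]) /\
    (forall i, [/\ 0 < D i, 0 < U2 i & 0 < U1 i]) /\
    (forall i j, A i j =
      imulmx (lower_bidiag L1) (imulmx (lower_bidiag L2)
        (imulmx (lower_bidiag L3) (imulmx (idiag_mx D)
          (imulmx (upper_bidiag U2) (upper_bidiag U1))))) i j).

Definition l2norm (R : realType) (x : nat -> R) : \bar R :=
  Lnorm counting 2%:E (EFin \o x).

(* As in [imulmx], the sum is meaningful for row-finite A. *)
Definition iapply (R : realType) (A : imatrix R) (x : nat -> R) : nat -> R :=
  fun i => \sum_(k \in [set: nat]) (A i k * x k).

Definition bounded_operator (R : realType) (A : imatrix R) : Prop :=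
  exists M : R, forall x : nat -> R, (l2norm x < +oo)%E ->
    (l2norm (iapply A x) <= M%:E * l2norm x)%E.

(** ** Truncations, Weyl functions *)

Definition corner (R : realType) (p q : nat) (A : imatrix R) : 'M[R]_(p, q) :=
  \matrix_(i, j) A i j.

(* The polynomial P_n; it is attached to the n x n truncation T^[n-1]. *)
Definition P_ (R : realType) (T : imatrix R) (n : nat) : {poly R} :=
  char_poly (corner n n T).

(* [I_r 0]; for n < r (which only concerns finitely many truncations) this is
   the r x n matrix with ones on the main diagonal. *)
Definition E_ (R : nzRingType) (r n : nat) : 'M[R]_(r, n) := pid_mx r.

Definition nu_mx (R : realType) (nu11 nu12 nu22 : R) : 'M[R]_3 :=
  \matrix_(i, j) nth 0 (nth [::] [:: [:: 1;    0;    0];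
                                     [:: nu11; 1;    0];
                                     [:: nu12; nu22; 1]] i) j.

Definition xi_mx (R : realType) (xi11 : R) : 'M[R]_2 :=
  \matrix_(i, j) nth 0 (nth [::] [:: [:: 1;    0];
                                     [:: xi11; 1]] i) j.

Section Weyl.
Variables (R : realType) (T : imatrix R) (nu : 'M[R]_3) (xi : 'M[R]_2).

Local Notation toC := (real_complex R).

Definition zsubT (N : nat) (z : R[i]) : 'M[R[i]]_N.+1 :=
  z%:M - map_mx toC (corner N.+1 N.+1 T).

(* With [P1 N] the polynomial P^(1)_{N+1}. *)
Definition P1 (N : nat) (z : R[i]) : 'M[R[i]]_(2, 3) :=
  map_mx toC (invmx xi) *m E_ _ 2 N.+1 *m \adj (zsubT N z)
    *m (E_ _ 3 N.+1)^T *m map_mx toC (invmx nu)^T.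

Definition P1_div_P (N : nat) (z : R[i]) : 'M[R[i]]_(2, 3) :=
  ((map_poly toC (P_ T N.+1)).[z])^-1 *: P1 N z.

Definition S_ (N : nat) (z : R[i]) : 'M[R[i]]_(2, 3) :=
  map_mx toC (invmx xi) *m E_ _ 2 N.+1 *m invmx (zsubT N z)
    *m (E_ _ 3 N.+1)^T *m map_mx toC (invmx nu)^T.

End Weyl.

(** ** The interval Delta and the spectral matrix of measures *)

Definition zeros (R : realType) (T : imatrix R) : set R :=
  [set x | exists N, root (P_ T N.+1) x].

(* Smallest closed interval containing the zeros. *)
Definition Delta (R : realType) (T : imatrix R) : set R :=
  \bigcap_(I in [set I : set R | [/\ closed I, is_interval I & zeros T `<=` I]]) I.

(* Integral with respect to a finite signed measure, through its Jordan
   decomposition (which does not depend on the Hahn decomposition chosen). *)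
Definition charge_integral (R : realType) (m : {charge set R -> \bar R})
    (D : set R) (f : R -> R) : R :=
  let P := cid (Hahn_decomposition m) in
  let N := cid (projT2 P) in
  Rintegral (jordan_pos (projT2 N)) D f - Rintegral (jordan_neg (projT2 N)) D f.

Definition Ccharge_integral (R : realType) (m : {charge set R -> \bar R})
    (D : set R) (f : R -> R[i]) : R[i] :=
  Complex (charge_integral m D (fun x => complex.Re (f x)))
          (charge_integral m D (fun x => complex.Im (f x))).

(* [corner 2 3 (T^n)] is E_[2] T^n E_[3]^T for the semi-infinite E_[r]. *)
Definition spectral_matrix (R : realType) (T : imatrix R) (nu : 'M[R]_3)
    (xi : 'M[R]_2) (psi : 'I_2 -> 'I_3 -> {charge set R -> \bar R}) : Prop :=
  (forall b a (A : set R), measurable A -> A `&` Delta T = set0 ->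
     psi b a A = 0%E) /\
  (forall n : nat,
     \matrix_(b, a) charge_integral (psi b a) (Delta T) (fun x => x ^+ n) =
     invmx xi *m corner 2 3 (iexpmx T n) *m (invmx nu)^T).

Definition psi_hat (R : realType) (T : imatrix R)
    (psi : 'I_2 -> 'I_3 -> {charge set R -> \bar R}) (z : R[i]) :
    'M[R[i]]_(2, 3) :=
  \matrix_(b, a) Ccharge_integral (psi b a) (Delta T)
                   (fun x => (z - real_complex R x)^-1).

(** ** The Riemann sphere *)

(* The topology lives on [R[i]^o], an alias of [R[i]]. *)
Definition sphere (R : realType) := one_point_compactification R[i]^o.

Definition sphere_embed (R : realType) (x : R) : sphere R :=
  Some (real_complex R x).

(* The value at infinity is the limit of [f z] as z tends to infinity. *)
Definition sphere_ext (R : realType) (f : R[i] -> 'M[R[i]]_(2, 3))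
    (z : sphere R) : 'M[R[i]^o]_(2, 3) :=
  if z is Some w then f w
  else lim ((f w^-1 : 'M[R[i]^o]_(2, 3)) @[w --> (0 : R[i]^o)^']).

Definition cvg_compacts (R : realType) (D : set R)
    (f : nat -> R[i] -> 'M[R[i]]_(2, 3)) (g : R[i] -> 'M[R[i]]_(2, 3)) : Prop :=
  forall K : set (sphere R), compact K -> K `&` (@sphere_embed R @` D) = set0 ->
    {uniform K, (fun N => sphere_ext (f N)) @ \oo --> sphere_ext g}.

(* Main.v *)
Require Import Defs.
From HB Require Import structures.
From mathcomp Require Import all_boot all_order all_algebra all_fingroup complex.
From mathcomp Require Import all_classical all_reals all_analysis.
From mathcomp Require Import measurable_realfun.
From mathcomp Require Import ring lra zify.
Import Order.TTheory GRing.Theory Num.Theory.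
Import numFieldNormedType.Exports.

(** The truncation of T + sI is a product of positive bidiagonal matrices
    A = L B U, and for Q = U L the moments of A between U and L are
    (U A^n L)_00 = (Q (B Q)^n)_00.  Their Hankel matrix is a product of totally
    nonnegative matrices, and Cauchy-Binet makes its leading minors positive, so
    (U p(A)^2 L)_00 > 0 for every nonzero polynomial p of degree at most N.
    Taking U = L = 1, the eigenvalues of the truncation are real and simple; for
    the other choices of U and L (U_1; L_1 and L_1 L_2) the residues of the
    corresponding resolvent entries are positive with a sum that does not depend
    on N.  The entries of the 2 x 3 corner of the resolvent are fixed
    combinations of these, so S^[N] is the Stieltjes transform of discrete
    measures on Delta of uniformly bounded total variation, whose moments agree
    with those of psi up to an order growing with N.  A point outside Delta is
    separated from it by a disc; outside this disc 1/(z - x) is, uniformly for x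
    in Delta, the sum of a geometric series of polynomials in x, so agreement of
    the moments gives uniform convergence there, and finitely many such discs
    suffice for a compact subset of the sphere. *)

Set Implicit Arguments.
Unset Strict Implicit.
Unset Printing Implicit Defensive.

Local Open Scope classical_set_scope.
Local Open Scope ring_scope.

(** * Minors and total nonnegativity *)

(** Rows and columns are picked by total functions on nat of which only the first [k] values matter,
    so deleting the first row or column is composition with [S]. *)
Definition minor (R : comNzRingType) (M : nat -> nat -> R) (f g : nat -> nat)
    (k : nat) : R := \det (\matrix_(i < k, j < k) M (f i) (g j)).

Definition mul_trunc (R : comNzRingType) (n : nat) (A B : nat -> nat -> R) :
    nat -> nat -> R :=
  fun i j => \sum_(k < n) A i k * B k j.

Definition increasing (k : nat) (f : nat -> nat) : Prop :=
  forall i j, (i < j < k)%N -> (f i < f j)%N.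

Section Minors.
Variable R : comNzRingType.
Implicit Types (A B M : nat -> nat -> R) (f g h : nat -> nat).

Lemma minor0 M f g : minor M f g 0 = 1.
Proof. exact: det_mx00. Qed.

Lemma eq_minor A B f g f' g' k :
  (forall i j, (i < k)%N -> (j < k)%N -> A (f i) (g j) = B (f' i) (g' j)) ->
  minor A f g k = minor B f' g' k.
Proof. by move=> e; congr (\det _); apply/matrixP=> i j; rewrite !mxE e. Qed.

Lemma minor_tr M f g k : minor (fun i j => M j i) f g k = minor M g f k.
Proof. by rewrite /minor -det_tr; congr (\det _); apply/matrixP=> i j; rewrite !mxE. Qed.

Lemma minor_row0 M f g k :
  (forall j, (0 < j < k.+1)%N -> M (f 0%N) (g j) = 0) ->
  minor M f g k.+1 = M (f 0%N) (g 0%N) * minor M (f \o S) (g \o S) k.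
Proof.
move=> z; rewrite /minor (expand_det_row _ ord0) big_ord_recl big1 ?addr0.
  rewrite /cofactor addn0 expr0 mul1r mxE; congr (_ * \det _).
  by apply/matrixP=> i j; rewrite !mxE.
by move=> i _; rewrite mxE z ?mul0r // lift0 /= ltnS ltn_ord.
Qed.

Lemma minor_col0 M f g k :
  (forall i, (0 < i < k.+1)%N -> M (f i) (g 0%N) = 0) ->
  minor M f g k.+1 = M (f 0%N) (g 0%N) * minor M (f \o S) (g \o S) k.
Proof.
move=> z; rewrite -minor_tr minor_row0 // minor_tr //.
Qed.

Lemma minor_noninj_col M f (h : nat -> nat) k :
  ~ {in [pred i | (i < k)%N] &, injective h} -> minor M f h k = 0.
Proof.
move=> nh; have [i /existsP [j /andP [ij /eqP e]]|] :=
  pickP (fun i : 'I_k => [exists j : 'I_k, (i != j) && (h i == h j)]).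
  rewrite /minor -det_tr; apply: (determinant_alternate ij) => l.
  by rewrite !mxE e.
move=> no; case: nh => i j /= ik jk e; apply/eqP; case: eqP => // ij.
have /= /existsP [] := no (Ordinal ik).
by exists (Ordinal jk); rewrite e eqxx andbT; apply/eqP => /(congr1 val).
Qed.

(** Multilinearity in the rows: row [i] of the product is a combination of the rows of [B], and
    [h i] records the one picked. *)
Lemma det_mulmx_sum_rowsub k n (A : 'M[R]_(k, n)) (B : 'M[R]_(n, k)) :
  \det (A *m B) =
  \sum_(h : {ffun 'I_k -> 'I_n}) (\prod_i A i (h i)) * \det (rowsub h B).
Proof.
under [RHS]eq_bigr => h _ do rewrite /determinant mulr_sumr.
rewrite exchange_big; apply: eq_bigr => s _ /=.
under eq_bigr => i _ do rewrite mxE.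
rewrite bigA_distr_bigA mulr_sumr; apply: eq_bigr => h _ /=.
rewrite big_split mulrCA; congr (_ * (_ * _)).
by apply: eq_bigr => i _; rewrite mxE.
Qed.

(* Each k-subset of indices is counted k! times, which avoids sorting the
   index maps in the usual Cauchy-Binet formula. *)
Lemma det_mulmx_cauchy_binet k n (A : 'M[R]_(k, n)) (B : 'M[R]_(n, k)) :
  \det (A *m B) *+ k`! =
  \sum_(h : {ffun 'I_k -> 'I_n}) \det (colsub h A) * \det (rowsub h B).
Proof.
(* Permuting the summation index [h] by [s] costs the sign of [s], so every permutation gives an
   expression for the same determinant; summed over [s], these expressions assemble the minors of
   [A]. *)
have e (s : 'S_k) : \det (A *m B) = \sum_(h : {ffun 'I_k -> 'I_n})
    (-1) ^+ s * (\prod_i A i (h (s i))) * \det (rowsub h B).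
  rewrite det_mulmx_sum_rowsub.
  pose p (t : 'S_k) (h : {ffun 'I_k -> 'I_n}) := [ffun i => h (t i)].
  have pK t : cancel (p t) (p t^-1%g).
    by move=> h; apply/ffunP=> i; rewrite !ffunE permKV.
  rewrite (reindex_inj (can_inj (pK s))); apply: eq_bigr => h _.
  rewrite (_ : rowsub (p s h) B = row_perm s (rowsub h B)); last first.
    by apply/matrixP=> i j; rewrite !mxE ffunE.
  rewrite row_permE det_mulmx det_perm mulrCA mulrA; congr (_ * _ * _).
  by apply: eq_bigr => i _; rewrite ffunE.
have -> : \det (A *m B) *+ k`! = \sum_(s : 'S_k) \det (A *m B).
  by rewrite sumr_const card_Sn.
under eq_bigr => s _ do rewrite (e s).
rewrite exchange_big; apply: eq_bigr => h _ /=.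
rewrite -mulr_suml /determinant; congr (_ * _).
by apply: eq_bigr => s _; congr (_ * _); apply: eq_bigr => i _; rewrite mxE.
Qed.

(** The default 0 beyond [k] is never read by a minor of size [k]. *)
Definition ext_ord k n (h : 'I_k -> 'I_n) (j : nat) : nat :=
  oapp (fun i => h i : nat) 0%N (insub j).

Lemma ext_ordE k n (h : 'I_k -> 'I_n) (i : 'I_k) : ext_ord h i = h i.
Proof. by rewrite /ext_ord valK. Qed.

Lemma minor_mul_trunc n A B f g k :
  minor (mul_trunc n A B) f g k *+ k`! =
  \sum_(h : {ffun 'I_k -> 'I_n}) minor A f (ext_ord h) k * minor B (ext_ord h) g k.
Proof.
rewrite /minor (_ : \matrix_(i, j) _ = (\matrix_(i < k, j < n) A (f i) j) *m
  (\matrix_(i < n, j < k) B i (g j))); last first.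
  by apply/matrixP=> i j; rewrite !mxE; apply: eq_bigr => l _; rewrite !mxE.
rewrite det_mulmx_cauchy_binet; apply: eq_bigr => h _.
by congr (_ * _); congr (\det _); apply/matrixP=> i j; rewrite !mxE ext_ordE.
Qed.

Lemma ext_ord_sort k n (h : 'I_k -> 'I_n) : injective h ->
  exists s : 'S_k, increasing k (ext_ord (h \o s)).
Proof.
move=> hI; pose t := [tuple (h i : nat) | i < k].
have ht (i : 'I_k) : tnth t i = h i.
  by rewrite tnth_mktuple.
pose t' := sort_tuple leq t.
have /tuple_permP [s es] : perm_eq t' t by rewrite perm_sort.
have sE (i : 'I_k) : nth 0%N t' i = h (s i).
  by rewrite es -(tnth_nth 0%N (mktuple (fun i => tnth t (s i)))) tnth_mktuple ht.
exists s => i j /andP [ij jk].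
have ik := ltn_trans ij jk.
have E l (lk : (l < k)%N) : ext_ord (h \o s) l = nth 0%N t' l.
  by rewrite (ext_ordE _ (Ordinal lk)); exact: esym (sE (Ordinal lk)).
rewrite !E //; apply: (@sorted_ltn_nth _ ltn) => //.
- exact: ltn_trans.
- rewrite ltn_sorted_uniq_leq sort_uniq (sort_sorted leq_total) andbT.
  rewrite map_inj_uniq ?enum_uniq // => a b /val_inj /hI //.
- by rewrite inE size_tuple.
- by rewrite inE size_tuple.
Qed.

Lemma minor_perm_col k n M f (h : 'I_k -> 'I_n) (s : 'S_k) :
  minor M f (ext_ord (h \o s)) k = (-1) ^+ s * minor M f (ext_ord h) k.
Proof.
rewrite /minor -[X in _ * X]det_tr -det_perm -det_mulmx -row_permE -det_tr.
by congr (\det _); apply/matrixP=> i j; rewrite !mxE !ext_ordE.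
Qed.

Lemma minor_perm_row k n M g (h : 'I_k -> 'I_n) (s : 'S_k) :
  minor M (ext_ord (h \o s)) g k = (-1) ^+ s * minor M (ext_ord h) g k.
Proof. by rewrite -!(minor_tr M) minor_perm_col. Qed.

(** Sorting [h] multiplies both minors by the same sign, so their product is unchanged; a
    non-injective [h] repeats a column. Signs of Cauchy-Binet terms therefore need checking on
    increasing index maps only. *)
Lemma minor_mul_sort n A B f g k (h : 'I_k -> 'I_n) :
  (exists s : 'S_k, increasing k (ext_ord (h \o s)) /\
    minor A f (ext_ord h) k * minor B (ext_ord h) g k =
    minor A f (ext_ord (h \o s)) k * minor B (ext_ord (h \o s)) g k) \/
  minor A f (ext_ord h) k * minor B (ext_ord h) g k = 0.
Proof.
have [/injectiveP hI|/injectiveP nh] := boolP (injectiveb h).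
  have [s hs] := ext_ord_sort hI; left; exists s; split => //.
  by rewrite minor_perm_col minor_perm_row mulrACA -signr_addb addbb mul1r.
right; rewrite minor_noninj_col ?mul0r // => eI; apply: nh => i j e.
by apply/val_inj/eI; rewrite ?inE ?ltn_ord // ?ext_ordE ?e.
Qed.
End Minors.

(** * Totally nonnegative arrays and strict positivity of selected minors *)

Section TotalPositivity.
Variable R : realFieldType.
Implicit Types (A B M P Q : nat -> nat -> R) (f g h : nat -> nat).

Definition totally_nonneg M := forall k f g,
  increasing k f -> increasing k g -> 0 <= minor M f g k.

Lemma totally_nonneg_tr M :
  totally_nonneg M -> totally_nonneg (fun i j => M j i).
Proof. by move=> tn k f g fI gI; rewrite minor_tr tn. Qed.

Section Product.
Variables (n k : nat) (A B : nat -> nat -> R) (f g : nat -> nat).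
Hypothesis A0 : forall h, increasing k h -> 0 <= minor A f h k.
Hypothesis B0 : forall h, increasing k h -> 0 <= minor B h g k.

Let term_ge0 (h : 'I_k -> 'I_n) :
  0 <= minor A f (ext_ord h) k * minor B (ext_ord h) g k.
Proof.
by case: (minor_mul_sort A B f g h) => [[s [hs ->]]|->//]; rewrite mulr_ge0 ?A0 ?B0.
Qed.

Lemma minor_mul_ge0 : 0 <= minor (mul_trunc n A B) f g k.
Proof.
by rewrite -(@pmulrn_lge0 _ _ k`!) ?fact_gt0 // minor_mul_trunc sumr_ge0.
Qed.

(** All Cauchy-Binet terms are nonnegative, so one positive term, at the intermediate indices [h],
    suffices. *)
Lemma minor_mul_gt0 h : (forall i, (i < k)%N -> (h i < n)%N) ->
  0 < minor A f h k -> 0 < minor B h g k -> 0 < minor (mul_trunc n A B) f g k.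
Proof.
move=> hn Ah Bh; rewrite -(@pmulrn_lgt0 _ _ k`!) ?fact_gt0 // minor_mul_trunc.
pose h' := [ffun i : 'I_k => Ordinal (hn i (ltn_ord i))].
have h'E i : (i < k)%N -> ext_ord h' i = h i.
  by move=> ik; rewrite (ext_ordE h' (Ordinal ik)) ffunE.
rewrite (bigD1 h') //= ltr_pwDl ?sumr_ge0 //.
rewrite (eq_minor (B := A) (f' := f) (g' := h)); last by move=> *; rewrite h'E.
rewrite (eq_minor (A := B) (B := B) (f' := h) (g' := g)) ?mulr_gt0 //.
by move=> *; rewrite h'E.
Qed.
End Product.

Lemma totally_nonneg_mul n A B :
  totally_nonneg A -> totally_nonneg B -> totally_nonneg (mul_trunc n A B).
Proof. by move=> tA tB k f g fI gI; apply: minor_mul_ge0 => h hI; auto. Qed.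

Lemma increasingS k f : increasing k.+1 f -> increasing k (f \o S).
Proof. by move=> fI i j ij; apply: fI; rewrite !ltnS. Qed.

Lemma increasing_gt0 k f j : increasing k f -> (0 < j < k)%N -> (f 0%N < f j)%N.
Proof. exact. Qed.

(** In a lower bidiagonal array, if [f 0 <= g 0] the first row of the minor vanishes after its first
    entry, and otherwise the first column does. Either way the first entry splits off, and induction
    applies. *)
Lemma totally_nonneg_bidiag M :
  (forall i j, 0 <= M i j) ->
  (forall i j, ~~ (j <= i <= j.+1)%N -> M i j = 0) -> totally_nonneg M.
Proof.
move=> M0 Mb; elim=> [|k IH] f g fI gI; first by rewrite minor0.
have [fg|gf] := leqP (f 0%N) (g 0%N); [rewrite minor_row0|rewrite minor_col0];
  rewrite ?mulr_ge0 ?IH //; try exact: increasingS.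
- by move=> j /(increasing_gt0 gI) gj; apply: Mb; lia.
- by move=> j /(increasing_gt0 fI) fj; apply: Mb; lia.
Qed.

Definition principal_pos n M := forall k f, increasing k f ->
  (forall i, (i < k)%N -> (f i < n)%N) -> 0 < minor M f f k.

Lemma principal_pos_tr n M :
  principal_pos n M -> principal_pos n (fun i j => M j i).
Proof. by move=> p k f fI fn; rewrite minor_tr; apply: p. Qed.

Lemma principal_pos_mul n A B : totally_nonneg A -> totally_nonneg B ->
  principal_pos n A -> principal_pos n B -> principal_pos n (mul_trunc n A B).
Proof.
move=> tA tB pA pB k f fI fn.
by apply: (@minor_mul_gt0 _ _ _ _ _ _ _ _ f) => // *; auto.
Qed.

Lemma principal_pos_lower n M :
  (forall i, 0 < M i i) -> (forall i j, (i < j)%N -> M i j = 0) ->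
  principal_pos n M.
Proof.
move=> M0 Mz; elim=> [|k IH] f fI fn; first by rewrite minor0.
rewrite minor_row0; last by move=> j /(increasing_gt0 fI) /Mz.
by rewrite mulr_gt0 // IH //; [exact: increasingS|move=> i ik; exact: fn].
Qed.

(** Rows 0 to k-1 against columns 1 to k. These minors carry the strictness that lets successive
    powers reach a new coordinate. *)
Definition superdiag_pos n M := forall k, (k < n)%N -> 0 < minor M id S k.

Lemma increasing_id k : increasing k id.
Proof. by move=> i j /andP []. Qed.

Lemma increasing_succ k : increasing k S.
Proof. by move=> i j /andP []. Qed.

Hint Resolve increasing_id increasing_succ : core.

Lemma superdiag_pos_mull n A B : totally_nonneg A -> totally_nonneg B ->
  principal_pos n A -> superdiag_pos n B -> superdiag_pos n (mul_trunc n A B).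
Proof.
move=> tA tB pA sB k kn.
apply: (@minor_mul_gt0 _ _ _ _ _ _ _ _ id) => *; auto; first lia.
by apply: pA => // i ik; lia.
Qed.

Lemma superdiag_pos_mulr n A B : totally_nonneg A -> totally_nonneg B ->
  superdiag_pos n A -> principal_pos n B -> superdiag_pos n (mul_trunc n A B).
Proof.
move=> tA tB sA pB k kn.
apply: (@minor_mul_gt0 _ _ _ _ _ _ _ _ S) => *; auto; first lia.
by apply: pB => // i ik; lia.
Qed.

(** Row [m] is the first row of the [m]-th power of the truncation of [P] to size [n]. *)
Fixpoint first_rows n P (m : nat) : nat -> R :=
  if m is m'.+1 then fun j => \sum_(k < n) first_rows n P m' k * P k j
  else fun j => (j == 0%N)%:R.

(** Induction on a bound [b] for the row indices: row [m+1] is row [m] times [P], so positive row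
    indices can be lowered by one through Cauchy-Binet. *)
Lemma totally_nonneg_first_rows n P :
  totally_nonneg P -> totally_nonneg (first_rows n P).
Proof.
move=> tP; suff claim b : forall k f g, increasing k f -> increasing k g ->
    (forall i, (i < k)%N -> (f i < b)%N) -> 0 <= minor (first_rows n P) f g k.
  move=> [|k] f g fI gI; first by rewrite minor0.
  apply: (claim (f k).+1) => // i; rewrite !ltnS leq_eqVlt => /predU1P [->//|ik].
  by apply/ltnW/fI; rewrite ik /=.
elim: b => [|b IH] k f g fI gI fb.
  by case: k fI gI fb => [|k] _ _ fb; [rewrite minor0|have := fb _ (ltn0Sn k)].
(* Minors avoiding row 0 are minors of the product of [first_rows] with [P], at row indices lowered
   by one. *)
have step k' f' g' : increasing k' f' -> increasing k' g' ->
    (forall i, (i < k')%N -> (0 < f' i <= b)%N) ->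
    0 <= minor (first_rows n P) f' g' k'.
  move=> fI' gI' fb'.
  rewrite (eq_minor (B := mul_trunc n (first_rows n P) P)
                    (f' := predn \o f') (g' := g')); last first.
    by move=> i j ik _ /=; have /andP [] := fb' i ik; case: (f' i).
  apply: minor_mul_ge0 => h hI; last exact: tP.
  apply: IH => // [i j ijk|i ik] /=.
    have /fb' := ltn_trans (proj1 (andP ijk)) (proj2 (andP ijk)).
    by have := fI' _ _ ijk; case/andP: ijk => _ /fb'; lia.
  by have := fb' i ik; lia.
case: k fI gI fb => [|k] fI gI fb; first by rewrite minor0.
(* Row 0 can only occur as the first row of the minor; it is a unit vector and is expanded away,
   which leaves positive row indices. *)
have [f0|f0] := posnP (f 0%N); last first.
  apply: step => // i ik; have := fb i ik; rewrite ltnS => ->; rewrite andbT.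
  by case: i ik => // i ik; apply: leq_trans f0 (ltnW _); apply: fI.
rewrite minor_row0 f0 /=; last first.
  by move=> j /(increasing_gt0 gI) ; case: (g j).
rewrite mulr_ge0 ?ler0n // step //; try exact: increasingS.
move=> i ik; have := fb i.+1 ik; rewrite ltnS => ->; rewrite andbT.
by rewrite -f0; apply: fI.
Qed.

(** Expanding along row 0 leaves rows 1 to k and columns 1 to k. These rows are earlier rows times
    [P], and the intermediate indices 0 to k-1 give the leading minor of size [k] times a
    superdiagonal minor of [P]. *)
Lemma first_rows_lead_pos n P k : totally_nonneg P -> superdiag_pos n P ->
  (k <= n)%N -> 0 < minor (first_rows n P) id id k.
Proof.
move=> tP sP; elim: k => [|k IH] kn; first by rewrite minor0.
rewrite minor_row0; last by move=> j /andP []; case: j.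
rewrite mul1r;
apply: (@minor_mul_gt0 n k (first_rows n P) P id S _ _ id) => [h hI|h hI|||]; auto.
- exact: totally_nonneg_first_rows.
- by move=> i ik; lia.
Qed.

(** Cauchy-Binet is applied twice, with intermediate indices 0 to k-1 each time: the resulting term
    is a product of three positive leading minors. *)
Lemma hankel_lead_pos n P P' Q k :
  totally_nonneg P -> totally_nonneg P' -> totally_nonneg Q ->
  superdiag_pos n P -> superdiag_pos n P' -> principal_pos n Q -> (k <= n)%N ->
  0 < minor (mul_trunc n (mul_trunc n (first_rows n P) Q)
                         (fun i j => first_rows n P' j i)) id id k.
Proof.
move=> tP tP' tQ sP sP' pQ kn.
have tO := totally_nonneg_first_rows n tP.
have tO' := totally_nonneg_tr (totally_nonneg_first_rows n tP').
have tOQ := totally_nonneg_mul n tO tQ.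
have idn i : (i < k)%N -> (i < n)%N by lia.
apply: (@minor_mul_gt0 n k _ _ id id _ _ id) => //.
- by move=> h hI; apply: tOQ.
- by move=> h hI; apply: tO'.
- apply: (@minor_mul_gt0 n k _ _ id id _ _ id) => //.
  + by move=> h hI; apply: tO.
  + by move=> h hI; apply: tQ.
  + exact: first_rows_lead_pos.
  + exact: pQ.
- by rewrite minor_tr first_rows_lead_pos.
Qed.

End TotalPositivity.

(** * Positivity of the moment form *)

Section QuadraticForm.
Variable R : realFieldType.
Implicit Types (H : nat -> nat -> R).

Definition schur H : nat -> nat -> R :=
  fun i j => H i.+1 j.+1 - H i.+1 0%N / H 0%N 0%N * H 0%N j.+1.

Lemma minor_schur H k : H 0%N 0%N != 0 ->
  minor H id id k.+1 = H 0%N 0%N * minor (schur H) id id k.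
Proof.
move=> h0.
(* Gaussian elimination of the first column: [L] is unitriangular, and [M] is the array after the
   row operations. *)
pose L := \matrix_(i < k.+1, j < k.+1)
  ((i == j)%:R - (if (j == 0) && (i != 0) then H i 0%N / H 0%N 0%N else 0)).
pose M i j := if i is i'.+1 then H i'.+1 j - H i'.+1 0%N / H 0%N 0%N * H 0%N j
              else H 0%N j.
have -> : minor H id id k.+1 = minor M id id k.+1.
  have dL : \det L = 1.
    rewrite det_trig; last first.
      apply/is_trig_mxP => i j ij; rewrite mxE.
      have /negbTE -> : i != j by apply: contraTneq ij => ->; rewrite ltnn.
      case: eqP => [j0|_]; last by rewrite subrr.
      by rewrite j0 ltn0 in ij.
    by rewrite big1 // => i _; rewrite mxE eqxx; case: eqP; rewrite subr0.
  rewrite /minor -[LHS]mul1r -dL -det_mulmx; congr (\det _).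
  apply/matrixP=> i j; rewrite !mxE.
  under eq_bigr => l _ do rewrite !mxE mulrBl.
  rewrite sumrB (bigD1 i) //= eqxx mul1r big1 ?addr0; last first.
    by move=> l li; rewrite eq_sym (negbTE li) mul0r.
  rewrite (bigD1 ord0) //= big1 ?addr0; last first.
    by move=> l l0; rewrite -val_eqE /= in l0; rewrite -val_eqE /= (negbTE l0) /= mul0r.
  rewrite /M; case: i => [[|i] iP] /=; first by rewrite mul0r subr0.
  by [].
rewrite minor_col0; last by move=> [//|i] _ /=; rewrite divfK // subrr.
by congr (_ * _); apply: eq_minor.
Qed.

(** Sylvester's criterion by completing the square in [v 0]: what remains is the form of the Schur
    complement on the shifted vector, whose leading minors are again positive. *)
Lemma sylvester n H (v : nat -> R) : (forall i j, H i j = H j i) ->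
  (forall k, (k <= n)%N -> 0 < minor H id id k) ->
  (exists2 i, (i < n)%N & v i != 0) ->
  0 < \sum_(i < n) \sum_(j < n) v i * v j * H i j.
Proof.
elim: n H v => [|n IH] H v sym mpos [i ilt vi].
  by rewrite ltn0 in ilt.
have H0 : 0 < H 0%N 0%N by have := mpos 1%N isT; rewrite /minor det_mx11 mxE.
have Hn0 := lt0r_neq0 H0.
pose s := \sum_(j < n) v j.+1 * H 0%N j.+1.
pose q := \sum_(i < n) \sum_(j < n) v i.+1 * v j.+1 * H i.+1 j.+1.
have -> : \sum_(i < n.+1) \sum_(j < n.+1) v i * v j * H i j =
    v 0%N ^+ 2 * H 0%N 0%N + 2%:R * v 0%N * s + q.
  rewrite big_ord_recl big_ord_recl /=.
  under [X in _ + X]eq_bigr => a _ do rewrite big_ord_recl /=.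
  rewrite big_split /= -!/q.
  have -> : \sum_(j < n) v 0%N * v (bump 0 j) * H 0%N (bump 0 j) = v 0%N * s.
    by rewrite mulr_sumr; apply: eq_bigr => a _; rewrite mulrA.
  have -> : \sum_(j < n) v (bump 0 j) * v 0%N * H (bump 0 j) 0%N = v 0%N * s.
    by rewrite mulr_sumr; apply: eq_bigr => a _; rewrite sym mulrA (mulrC (v 0%N)).
  rewrite -/q; ring.
have qE : \sum_(i < n) \sum_(j < n) v i.+1 * v j.+1 * schur H i j =
    q - s ^+ 2 / H 0%N 0%N.
  rewrite /q expr2 {1}/s mulr_suml mulr_suml -sumrB; apply: eq_bigr => a _.
  rewrite /s mulr_sumr mulr_suml -sumrB; apply: eq_bigr => b _.
  rewrite /schur (sym a.+1 0%N); field; exact: Hn0.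
(* If a later coordinate is nonzero, the Schur part is positive by induction; otherwise only the
   square of [v 0] survives. *)
have [/existsP [j vj]|/existsPn no] := boolP [exists j : 'I_n, v j.+1 != 0].
  have := IH (schur H) (v \o S).
  rewrite /= qE => /(_ _ _ _) Q.
  have {}Q : 0 < q - s ^+ 2 / H 0%N 0%N.
    apply: Q; last by exists j.
    - by move=> a b; rewrite /schur (sym a.+1 b.+1) (sym a.+1) (sym _ b.+1); field.
    - by move=> k kn; have := mpos k.+1 kn; rewrite minor_schur // pmulr_rgt0.
  have -> : v 0%N ^+ 2 * H 0%N 0%N + 2%:R * v 0%N * s + q =
    H 0%N 0%N * (v 0%N + s / H 0%N 0%N) ^+ 2 + (q - s ^+ 2 / H 0%N 0%N) by field.
  by rewrite ltr_wpDl // mulr_ge0 ?sqr_ge0 // ltW.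
have vz (j : 'I_n) : v j.+1 = 0 by apply/eqP; have := no j; rewrite negbK.
have -> : s = 0 by rewrite /s big1 // => j _; rewrite vz mul0r.
have -> : q = 0 by rewrite /q big1 // => j _; rewrite big1 // => k _; rewrite vz !mul0r.
have v0 : v 0%N != 0.
  by case: i ilt vi => [//|i] ilt; rewrite (vz (Ordinal (ilt : (i < n)%N))) eqxx.
by rewrite mulr0 !addr0 mulr_gt0 // exprn_even_gt0.
Qed.

End QuadraticForm.

Section Corner.
Variable R : realType.
Implicit Types (A B P Q : imatrix R).

Lemma corner_mul_trunc n A B :
  corner n n (mul_trunc n A B) = corner n n A *m corner n n B.
Proof. by apply/matrixP=> i j; rewrite !mxE; apply: eq_bigr => k _; rewrite !mxE. Qed.

Lemma corner_tr n A : corner n n (fun i j => A j i) = (corner n n A)^T.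
Proof. by apply/matrixP=> i j; rewrite !mxE. Qed.

Lemma first_rowsE n P m (j : 'I_n.+1) :
  first_rows n.+1 P m j = (corner n.+1 n.+1 P ^+ m) 0 j.
Proof.
elim: m j => [|m IH] j /=; first by rewrite expr0 mxE eq_sym -val_eqE.
by rewrite exprSr mxE; apply: eq_bigr => k _; rewrite IH mxE.
Qed.

(** [P'] enters transposed, so that the right factor lists the first columns of its powers. *)
Lemma hankelE n P P' Q (i j : nat) :
  mul_trunc n.+1 (mul_trunc n.+1 (first_rows n.+1 P) Q)
     (fun i j => first_rows n.+1 (fun i j => P' j i) j i) i j =
  (corner n.+1 n.+1 P ^+ i * corner n.+1 n.+1 Q * corner n.+1 n.+1 P' ^+ j) 0 0.
Proof.
rewrite /mul_trunc !mxE; apply: eq_bigr => k _; rewrite !mxE; congr (_ * _).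
  by apply: eq_bigr => l _; rewrite first_rowsE mxE.
rewrite (first_rowsE (fun i j => P' j i)) corner_tr.
suff -> : (corner n.+1 n.+1 P')^T ^+ j = (corner n.+1 n.+1 P' ^+ j)^T by rewrite mxE.
elim: j => [|j IH]; first by rewrite !expr0 trmx1.
by rewrite exprS IH exprSr trmx_mul.
Qed.

End Corner.

Lemma horner_mx_sum (R : comNzRingType) n (X : 'M[R]_n.+1) (p : {poly R}) m :
  (size p <= m)%N -> horner_mx X p = \sum_(i < m) p`_i *: X ^+ i.
Proof.
move=> pm; rewrite -{1}(coefK p) (poly_def) raddf_sum /=.
under eq_bigr => i _ do rewrite linearZ /= rmorphXn /= horner_mx_X.
rewrite (big_ord_widen _ (fun i => p`_i *: X ^+ i) pm) big_mkcond.
apply: eq_bigr => i _; case: ltnP => // /(nth_default 0) ->.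
by rewrite scale0r.
Qed.

(** The left side depends on [i + j] only, which makes the moment matrix Hankel; the right side is
    the triple product whose leading minors are known to be positive. *)
Lemma conj_factor_exp (S : pzRingType) (U L B : S) i j :
  U * (L * B * U) ^+ (i + j) * L =
  (U * L * B) ^+ i * (U * L) * (B * (U * L)) ^+ j.
Proof.
elim: i => [|i IH].
  rewrite add0n expr0 mul1r; elim: j => [|j IH]; first by rewrite !expr0 !mulr1.
  by rewrite !exprSr; rewrite !mulrA in IH *; rewrite IH.
by rewrite addSn !exprS; rewrite -!mulrA in IH *; rewrite IH.
Qed.

(** Expanding [p] turns the entry into the quadratic form of the Hankel matrix of moments, evaluated
    at the coefficients of [p]. *)
Lemma sqr_form_gt0 (R : realType) n (U L B : imatrix R) (p : {poly R})
    (Q := mul_trunc n.+1 U L) (P := mul_trunc n.+1 Q B) (P' := mul_trunc n.+1 B Q)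
    (X := corner n.+1 n.+1 L * corner n.+1 n.+1 B * corner n.+1 n.+1 U) :
  totally_nonneg Q -> totally_nonneg B -> principal_pos n.+1 Q ->
  superdiag_pos n.+1 P -> superdiag_pos n.+1 (fun i j => P' j i) ->
  p != 0 -> (size p <= n.+1)%N ->
  0 < (corner n.+1 n.+1 U * horner_mx X p ^+ 2 * corner n.+1 n.+1 L) 0 0.
Proof.
move=> tQ tB pQ sP sP' p0 ps.
have tP : totally_nonneg P by exact: totally_nonneg_mul.
have tP' : totally_nonneg (fun i j => P' j i).
  by apply: totally_nonneg_tr; exact: totally_nonneg_mul.
pose u := corner n.+1 n.+1 U; pose l := corner n.+1 n.+1 L.
pose H i j := (u * X ^+ (i + j) * l) 0 0.
have HE i j : H i j = mul_trunc n.+1 (mul_trunc n.+1 (first_rows n.+1 P) Q)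
     (fun i j => first_rows n.+1 (fun i j => P' j i) j i) i j.
  rewrite hankelE /H conj_factor_exp /P /P' /Q !corner_mul_trunc.
  by [].
have -> : (u * horner_mx X p ^+ 2 * l) 0 0 =
    \sum_(i < n.+1) \sum_(j < n.+1) p`_i * p`_j * H i j.
  rewrite (horner_mx_sum _ ps) expr2 mulr_suml mulr_sumr mulr_suml summxE.
  apply: eq_bigr => i _; rewrite !mulr_sumr mulr_suml summxE; apply: eq_bigr => j _.
  by rewrite -scalerAl -scalerAr -scalerAr -scalerAl -scalerAr -scalerAl scalerA
     -exprD mxE mulrC.
apply: (@sylvester _ _ _ (fun i => p`_i)) => [i j|k kn|].
- by rewrite /H addnC.
- rewrite (eq_minor (B := mul_trunc n.+1 (mul_trunc n.+1 (first_rows n.+1 P) Q)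
     (fun i j => first_rows n.+1 (fun i j => P' j i) j i)) (f' := id) (g' := id)).
    exact: hankel_lead_pos.
  by move=> i j _ _; rewrite HE.
- exists (size p).-1; last by rewrite -lead_coefE lead_coef_eq0.
  by rewrite prednK // size_poly_gt0.
Qed.

(** * Spectrum and spectral projections *)

Section RealSpectrum.
Variables (R : rcfType) (n : nat) (X : 'M[R]_n.+1).
Hypothesis X_pos : forall p : {poly R}, p != 0 -> (size p <= n.+1)%N ->
  0 < (horner_mx X p ^+ 2) 0 0.

(* b != 0 excludes a nonreal root a + ib, b = 0 a double root a. *)
Lemma char_poly_no_sum_sqr (q d : {poly R}) (a b : R) :
  char_poly X = q * (('X - a%:P) ^+ 2 + (b ^+ 2)%:P) -> False.
Proof.
move=> e.
have q0 : q != 0.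
  apply/eqP => q0; have := monic_neq0 (char_poly_monic X).
  by rewrite e q0 mul0r eqxx.
have sd : size (('X - a%:P) ^+ 2 + (b ^+ 2)%:P) = 3%N.
  by rewrite size_polyDl size_exp_XsubC // ltnS (leq_trans (size_polyC_leq1 _)).
have sq : size q = n.
  have := congr1 (fun p : {poly R} => size p) e; rewrite size_char_poly size_mul //.
    by rewrite sd addn3 /= => -[<-].
  by rewrite -size_poly_eq0 sd.
(* By Cayley-Hamilton [q] times the characteristic polynomial annihilates [X]. This product is a sum
   of two squares, (q (X - a))^2 + b^2 q^2, and the corner entry of its first part is strictly
   positive. *)
have h0 : horner_mx X (q * (q * (('X - a%:P) ^+ 2 + (b ^+ 2)%:P))) = 0.
  by rewrite -e rmorphM /= Cayley_Hamilton mulr0.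
have hp : 0 < (horner_mx X (q * ('X - a%:P)) ^+ 2) 0 0.
  apply: X_pos; first by rewrite mulf_neq0 // polyXsubC_eq0.
  by rewrite size_Mmonic ?monicXsubC // size_XsubC sq addn2.
have hq : 0 < (horner_mx X q ^+ 2) 0 0 by apply: X_pos; rewrite ?sq.
have : (horner_mx X (q * ('X - a%:P)) ^+ 2) 0 0 + b ^+ 2 * (horner_mx X q ^+ 2) 0 0
    = 0.
  have := congr1 (fun M : 'M[R]_n.+1 => M 0 0) h0.
  rewrite [RHS]mxE => <-.
  rewrite (_ : q * (q * _) = (q * ('X - a%:P)) ^+ 2 + b ^+ 2 *: q ^+ 2); last first.
    by rewrite -mul_polyC; ring.
  rewrite raddfD /= linearZ /= !rmorphXn /=.
  by rewrite [RHS]mxE; congr (_ + _); rewrite [RHS]mxE.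
by apply/eqP/lt0r_neq0; rewrite ltr_pwDl // mulr_ge0 ?sqr_ge0 // ltW.
Qed.

(** A nonreal root would bring in a real quadratic factor (X - a)^2 + b^2, and a repeated root r the
    factor (X - r)^2; both are excluded. *)
Lemma char_poly_real_simple :
  exists2 rs : seq R, uniq rs & char_poly X = \prod_(r <- rs) ('X - r%:P).
Proof.
pose toC := real_complex R.
pose chi := char_poly X.
have chiC0 : map_poly toC chi != 0 by rewrite map_poly_eq0 monic_neq0 ?char_poly_monic.
have root_real z : root (map_poly toC chi) z -> complex.Im z = 0.
  move=> rz; apply/eqP; apply/negPn/negP => zb.
  pose a := complex.Re z; pose b := complex.Im z.
  pose d := ('X - a%:P) ^+ 2 + (b ^+ 2)%:P.
  have sd : size d = 3%N.
    by rewrite size_polyDl size_exp_XsubC // ltnS (leq_trans (size_polyC_leq1 _)).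
  have d0 : d != 0 by rewrite -size_poly_eq0 sd.
  have dz : (map_poly toC d).[z] = 0.
    rewrite /d rmorphD rmorphXn rmorphB /= map_polyX !map_polyC /= !hornerE.
    rewrite /a /b; case: (z) => x y /=; apply/eqP.
    by rewrite eq_complex expr2 /= !(subr0, add0r, addr0); apply/andP; split;
       apply/eqP; ring.
  suff /dvdpP [q e] : d %| chi by apply: (@char_poly_no_sum_sqr q 0 a b).
  (* The remainder modulo [d] is real of degree at most one and vanishes at the nonreal [z], hence
     is zero. *)
  have := rz; rewrite /root {1}(divp_eq chi d) rmorphD rmorphM /= hornerD hornerM dz.
  rewrite mulr0 add0r; set r := chi %% d => rz0.
  have sr : (size r <= 2)%N by rewrite -ltnS -sd ltn_modp.
  have rE : r = r`_1 *: 'X + (r`_0)%:P.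
    apply/polyP => k; rewrite coefD coefZ coefX coefC.
    case: k => [|[|k]] /=; rewrite ?mulr0 ?mulr1 ?add0r ?addr0 //.
    by rewrite nth_default // (leq_trans sr).
  move: rz0; rewrite rE rmorphD /= map_polyZ /= map_polyX map_polyC /= !hornerE.
  move: zb; rewrite /= ; case: (z) => x y /= y0.
  rewrite eq_complex /= !(mul0r, subr0, addr0) mulf_eq0 (negbTE y0) orbF.
  move=> /andP [/eqP e0 /eqP e1]; rewrite e1 mul0r add0r in e0.
  by apply/modp_eq0P; rewrite -/r rE e0 e1 scale0r addr0.
have [zs zsE] := closed_field_poly_normal (map_poly toC chi).
rewrite lead_coef_map (monicP (char_poly_monic X)) rmorph1 scale1r in zsE.
have zs_real z : z \in zs -> z = toC (complex.Re z).
  move=> zin; have /root_real : root (map_poly toC chi) z.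
    by rewrite zsE root_prod_XsubC.
  by case: (z) => x y /= ->.
pose rs := map (@complex.Re R) zs.
have chiE : chi = \prod_(r <- rs) ('X - r%:P).
  apply: (map_poly_inj toC); rewrite zsE rmorph_prod big_map /=.
  rewrite big_seq [RHS]big_seq; apply: eq_bigr => z /zs_real {1}->.
  by rewrite rmorphB /= map_polyX map_polyC.
exists rs => //; apply/negPn/negP => nu.
have [r [s rsE]] : exists r s, perm_eq rs [:: r, r & s].
  elim: rs nu {chiE} => //= x s IH; rewrite negb_and negbK => /orP [xs|/IH [r [t rt]]].
    by exists x, (rem x s); rewrite perm_cons perm_to_rem.
  exists r, (x :: t); apply: (@perm_trans _ (x :: [:: r, r & t])).
    by rewrite perm_cons.
  by apply/seq.permP => a /=; lia.
apply: (@char_poly_no_sum_sqr (\prod_(r <- s) ('X - r%:P)) 0 r 0).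
by rewrite -/chi chiE (perm_big _ rsE) !big_cons expr0n /= addr0 expr2 mulrA mulrC.
Qed.

End RealSpectrum.

Section SpectralProjections.
Variables (F : fieldType) (n : nat) (X : 'M[F]_n.+1) (rs : seq F).
Hypotheses (rs_uniq : uniq rs) (chiE : char_poly X = \prod_(r <- rs) ('X - r%:P)).

Definition lagrange_basis_poly (r : F) : {poly F} :=
  let m := \prod_(s <- rs | s != r) ('X - s%:P) in m.[r]^-1 *: m.

(** Projection onto the eigenspace of [r] along the others, written as a polynomial in [X] so that
    the positivity of squares of polynomials applies to it. *)
Definition spectral_proj (r : F) : 'M[F]_n.+1 := horner_mx X (lagrange_basis_poly r).

Lemma size_spectrum : size rs = n.+1.
Proof.
by have := size_char_poly X; rewrite chiE size_prod_XsubC => -[].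
Qed.

Lemma lagrange_basis_poly_den_neq0 r : (\prod_(s <- rs | s != r) ('X - s%:P)).[r] != 0.
Proof.
rewrite horner_prod prodf_seq_neq0; apply/allP => s _; apply/implyP => sr.
by rewrite hornerXsubC subr_eq0 eq_sym.
Qed.

Lemma lagrange_basis_poly_neq0 r : lagrange_basis_poly r != 0.
Proof.
rewrite scaler_eq0 invr_eq0 negb_or lagrange_basis_poly_den_neq0 /=.
by apply: contraNneq (lagrange_basis_poly_den_neq0 r) => ->; rewrite horner0.
Qed.

Lemma size_lagrange_basis_poly r : r \in rs -> (size (lagrange_basis_poly r) <= n.+1)%N.
Proof.
move=> rin; rewrite size_scale ?invr_neq0 ?lagrange_basis_poly_den_neq0 //.
rewrite -big_filter size_prod_XsubC -rem_filter // size_rem // size_spectrum.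
exact: leqnn.
Qed.

(** The factor X - r completes the Lagrange polynomial to a multiple of the characteristic
    polynomial, which vanishes at [X]. *)
Lemma mulr_spectral_proj r : r \in rs -> X * spectral_proj r = r *: spectral_proj r.
Proof.
move=> rin; apply/eqP; rewrite -subr_eq0 -[X in _ - X]mul_scalar_mx.
rewrite -[_ *m _]/(_ * _) -mulrBl -(horner_mx_C X) -{1}[X]horner_mx_X -rmorphB -rmorphM /=.
rewrite -scalerAr linearZ /=.
by rewrite -(bigD1_seq r) //= -chiE Cayley_Hamilton scaler0.
Qed.

Lemma horner_lagrange_basis_poly r s : r \in rs -> s \in rs ->
  (lagrange_basis_poly r).[s] = (s == r)%:R.
Proof.
move=> rin sin; rewrite hornerZ; case: (eqVneq s r) => [->|sr].
  by rewrite mulVf // lagrange_basis_poly_den_neq0.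
apply/eqP; rewrite mulf_eq0; apply/orP; right.
by rewrite horner_prod (big_rem s) //= sr hornerXsubC subrr mul0r.
Qed.

(** The Lagrange polynomials sum to a polynomial of size at most [n.+1] equal to 1 at [n.+1]
    distinct roots, hence to 1. *)
Lemma sum_spectral_proj : \sum_(r <- rs) spectral_proj r = 1.
Proof.
rewrite -(rmorph_sum (horner_mx X)) -[RHS](rmorph1 (horner_mx X)); congr horner_mx.
apply/eqP; rewrite -subr_eq0; apply/eqP.
apply: (@roots_geq_poly_eq0 _ _ rs) => //.
  apply/allP => s sin; rewrite rootE hornerD hornerN hornerC horner_sum.
  rewrite (bigD1_seq s) //= horner_lagrange_basis_poly // eqxx big_seq_cond big1 ?addr0 ?subrr //.
  by move=> r /andP [rin rs']; rewrite horner_lagrange_basis_poly // eq_sym (negbTE rs').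
rewrite size_spectrum (leq_trans (size_polyD _ _)) // geq_max.
rewrite size_polyN size_poly1 andbT; apply: (leq_trans (size_sum _ _ _)).
rewrite big_seq; elim/big_ind: _ => //= [x y *|r rin]; last exact: size_lagrange_basis_poly.
by rewrite geq_max; apply/andP.
Qed.

Lemma exp_spectral_proj m r : r \in rs ->
  X ^+ m * spectral_proj r = r ^+ m *: spectral_proj r.
Proof.
move=> rin; elim: m => [|m IH]; first by rewrite !expr0 mul1r scale1r.
by rewrite exprSr -mulrA mulr_spectral_proj // -scalerAr IH scalerA exprS.
Qed.

(** A polynomial in [X] acts on the projection by its value at [r], which is 1 for the Lagrange
    polynomial. Thus each projection is a square, to which the positivity of the form applies. *)
Lemma spectral_proj_idem r : r \in rs -> spectral_proj r ^+ 2 = spectral_proj r.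
Proof.
move=> rin; rewrite expr2 {1}/spectral_proj.
rewrite (horner_mx_sum X (leqnn _)) mulr_suml.
under eq_bigr => i _ do rewrite -scalerAl exp_spectral_proj // scalerA.
rewrite -scaler_suml -horner_coef horner_lagrange_basis_poly // eqxx scale1r //.
Qed.

Lemma exp_spectral_sum m : X ^+ m = \sum_(r <- rs) r ^+ m *: spectral_proj r.
Proof.
rewrite -[LHS]mulr1 -sum_spectral_proj mulr_sumr big_seq [RHS]big_seq.
by apply: eq_bigr => r; exact: exp_spectral_proj.
Qed.

Lemma resolvent_spectral_sum (K : fieldType) (f : {rmorphism F -> K}) (z : K) :
  (forall r, r \in rs -> z != f r) ->
  (z%:M - map_mx f X) *m
     (\sum_(r <- rs) (z - f r)^-1 *: map_mx f (spectral_proj r)) = 1%:M.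
Proof.
move=> zf; rewrite mulmx_sumr.
rewrite -[RHS](map_mx1 f) -[1%:M]sum_spectral_proj map_mx_sum.
rewrite big_seq [RHS]big_seq; apply: eq_bigr => r rin.
rewrite -scalemxAr mulmxBl -map_mxM -[X *m _]/(X * _).
rewrite mulr_spectral_proj // map_mxZ mul_scalar_mx -scalerBl.
by rewrite scalerA mulVf ?scale1r // subr_eq0 zf.
Qed.

End SpectralProjections.

(** * Truncations of the factorization *)

Section Truncation.
Variable R : realType.
Implicit Types (A B T : imatrix R).

Lemma fsbig_setT_ord n (f : nat -> R) : (forall k, (n <= k)%N -> f k = 0) ->
  \sum_(k \in [set: nat]) f k = \sum_(k < n) f k.
Proof.
move=> f0; rewrite fsbig_ord; apply/esym/fsbig_widen => //.
by move=> k [_ /= /negP]; rewrite -leqNgt => /f0.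
Qed.

(** A row of a lower triangular array stops at the diagonal, so indices from [n] on do not
    contribute. Truncation therefore respects a factorization with lower factors on the left and
    upper ones on the right. *)
Lemma corner_imulmx_lower n A B : (forall i k, (i < k)%N -> A i k = 0) ->
  corner n n (imulmx A B) = corner n n A *m corner n n B.
Proof.
move=> Al; apply/matrixP=> i j; rewrite !mxE /imulmx (@fsbig_setT_ord n).
  by apply: eq_bigr => k _; rewrite !mxE.
by move=> k nk; rewrite Al ?mul0r // (leq_trans (ltn_ord i)).
Qed.

Lemma corner_imulmx_upper n A B : (forall k j, (j < k)%N -> B k j = 0) ->
  corner n n (imulmx A B) = corner n n A *m corner n n B.
Proof.
move=> Bu; apply/matrixP=> i j; rewrite !mxE /imulmx (@fsbig_setT_ord n).
  by apply: eq_bigr => k _; rewrite !mxE.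
by move=> k nk; rewrite Bu ?mulr0 // (leq_trans (ltn_ord j)).
Qed.

Lemma lower_bidiag_tri (l : nat -> R) i k : (i < k)%N -> lower_bidiag l i k = 0.
Proof. by rewrite /lower_bidiag => ik; case: eqP => [|_]; [lia|case: eqP => //; lia]. Qed.

Lemma upper_bidiag_tri (l : nat -> R) k i : (i < k)%N -> upper_bidiag l k i = 0.
Proof. by rewrite /upper_bidiag => ik; case: eqP => [|_]; [lia|case: eqP => //; lia]. Qed.

Lemma idiag_mx_tri (l : nat -> R) i k : (i < k)%N -> idiag_mx l i k = 0.
Proof. by rewrite /idiag_mx => ik; case: eqP => [|//]; lia. Qed.

(** Each multiplication by [T] raises the index by at most 2, so [m] steps started at row [i] stay
    within 0 to N. *)
Lemma iexpmx_trunc T N m i j : banded T -> (i + 2 * m <= N)%N -> (j <= N)%N ->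
  iexpmx T m i j = (corner N.+1 N.+1 T ^+ m) (inord i) (inord j).
Proof.
move=> Tb; elim: m i => [|m IH] i iN jN.
  rewrite expr0 mxE /iexpmx /= /iscalar_mx -val_eqE /= !inordK //; last lia.
  by case: eqP.
rewrite exprS mxE /iexpmx /= -/(iexpmx T m) /imulmx (@fsbig_setT_ord N.+1); last first.
  by move=> k Nk; rewrite Tb ?mul0r //; lia.
apply: eq_bigr => k _; rewrite mxE inordK; last lia.
have [ki|ki] := leqP k (i + 2); first by rewrite IH // ?inord_val //; lia.
by rewrite Tb ?mul0r //; lia.
Qed.

End Truncation.

Section Factors.
Variables (R : realType) (n : nat).
Implicit Types (A B M : imatrix R) (l d : nat -> R).

Definition tn_factor M := totally_nonneg M /\ principal_pos n M.

Lemma tn_factor_mul A B : tn_factor A -> tn_factor B -> tn_factor (mul_trunc n A B).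
Proof.
move=> [tA pA] [tB pB].
by split; [exact: totally_nonneg_mul|exact: principal_pos_mul].
Qed.

Lemma tn_factor_tr M : tn_factor M -> tn_factor (fun i j => M j i).
Proof.
by move=> [tM pM]; split; [exact: totally_nonneg_tr|exact: principal_pos_tr].
Qed.

Lemma tn_factor_lower l : (forall i, 0 < l i) -> tn_factor (lower_bidiag l).
Proof.
move=> l0; split.
  apply: totally_nonneg_bidiag => i j; rewrite /lower_bidiag; case: eqP => [|e] //.
  - by case: eqP => // _; apply: ltW.
  - by move=> ->; lia.
  - by case: eqP => //; lia.
apply: principal_pos_lower; last exact: lower_bidiag_tri.
by move=> i; rewrite /lower_bidiag eqxx.
Qed.

Lemma upper_bidiagE l : upper_bidiag l = (fun i j => lower_bidiag l j i).
Proof.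
by apply/funext => i; apply/funext => j; rewrite /upper_bidiag /lower_bidiag eq_sym.
Qed.

Lemma tn_factor_upper l : (forall i, 0 < l i) -> tn_factor (upper_bidiag l).
Proof. by move=> l0; rewrite upper_bidiagE; exact/tn_factor_tr/tn_factor_lower. Qed.

Lemma tn_factor_diag d : (forall i, 0 < d i) -> tn_factor (idiag_mx d).
Proof.
move=> d0; split.
  apply: totally_nonneg_bidiag => i j; rewrite /idiag_mx; case: eqP => [|e] //.
  - by move=> _; apply: ltW.
  - by move=> ->; lia.
apply: principal_pos_lower; last exact: idiag_mx_tri.
by move=> i; rewrite /idiag_mx eqxx.
Qed.

(** Shifting the columns by one makes the array lower triangular with the positive entries [l] on
    the diagonal. *)
Lemma superdiag_pos_upper l : (forall i, 0 < l i) -> superdiag_pos n (upper_bidiag l).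
Proof.
move=> l0 k kn.
have -> : minor (upper_bidiag l) id S k =
    minor (fun i j => upper_bidiag l i j.+1) id id k by [].
apply: (@principal_pos_lower _ n) => //.
- by move=> i; rewrite /upper_bidiag eqxx; case: eqP => //; lia.
- by move=> i j ij; rewrite /upper_bidiag; case: eqP => [|_]; [lia|case: eqP => //; lia].
- exact: increasing_id.
- by move=> i ik; lia.
Qed.

Definition superfactor M := tn_factor M /\ superdiag_pos n M.

Lemma superfactor_mull A B :
  tn_factor A -> superfactor B -> superfactor (mul_trunc n A B).
Proof.
move=> fA [fB sB]; split; first exact: tn_factor_mul.
by case: fA fB => tA pA [tB pB]; exact: superdiag_pos_mull.
Qed.

Lemma superfactor_mulr A B :
  superfactor A -> tn_factor B -> superfactor (mul_trunc n A B).
Proof.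
move=> [fA sA] fB; split; first exact: tn_factor_mul.
by case: fA fB => tA pA [tB pB]; exact: superdiag_pos_mulr.
Qed.

Lemma mul_trunc_tr A B : (fun i j => mul_trunc n A B j i) =
  mul_trunc n (fun i j => B j i) (fun i j => A j i).
Proof.
apply/funext => i; apply/funext => j.
by apply: eq_bigr => k _; rewrite mulrC.
Qed.

End Factors.

(** Transfers polynomials in [T] to polynomials of the same degree in T + sI, the matrix that is
    factored. *)
Lemma horner_mx_shift (R : comNzRingType) n (X : 'M[R]_n.+1) (s : R) (p : {poly R}) :
  horner_mx (X - s%:M) p = horner_mx X (p \Po ('X - s%:P)).
Proof.
rewrite (horner_mx_sum _ (leqnn _)) comp_polyE raddf_sum /=; apply: eq_bigr => i _.
by rewrite linearZ /= rmorphXn rmorphB /= horner_mx_X horner_mx_C.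
Qed.

Section PBFTruncation.
Variables (R : realType) (N : nat).
Local Notation n := N.+1.
Local Notation cr := (corner n n).

(** Strictness requires a positive superdiagonal in U L P V, supplied by [U] or [V], and a positive
    subdiagonal in P V U L, supplied by [P]. *)
Lemma sqr_form_factors_gt0 (U L P V : imatrix R) (p : {poly R}) :
  tn_factor n U -> tn_factor n L -> tn_factor n P -> tn_factor n V ->
  superdiag_pos n U \/ superdiag_pos n V ->
  superdiag_pos n (fun i j => P j i) ->
  p != 0 -> (size p <= n)%N ->
  0 < (cr U * horner_mx (cr L * cr P * cr V * cr U) p ^+ 2 * cr L) 0 0.
Proof.
move=> fU fL fP fV sUV sP p0 ps.
have fQ := tn_factor_mul fU fL; have fB := tn_factor_mul fP fV.
have -> : cr L * cr P * cr V * cr U = cr L * cr (mul_trunc n P V) * cr U.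
  by rewrite corner_mul_trunc -[cr P *m _]/(_ * _) !mulrA.
apply: sqr_form_gt0 => //.
- by case: fQ.
- by case: fB.
- by case: fQ.
- case: sUV => [sU|sV].
    have [] // : superfactor n (mul_trunc n (mul_trunc n U L) (mul_trunc n P V)).
    by apply: superfactor_mulr => //; apply: superfactor_mulr => //; split.
  have [] // : superfactor n (mul_trunc n (mul_trunc n U L) (mul_trunc n P V)).
  by apply: superfactor_mull => //; apply: superfactor_mull => //; split.
- rewrite mul_trunc_tr.
  suff [] : superfactor n (mul_trunc n (fun i j => mul_trunc n U L j i)
     (fun i j => mul_trunc n P V j i)) by [].
  apply: superfactor_mull; first exact: tn_factor_tr.
  rewrite mul_trunc_tr; apply: superfactor_mull; first exact: tn_factor_tr.
  by split => //; exact: tn_factor_tr.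
Qed.

Variables (T : imatrix R) (s : R) (L1 L2 L3 D U2 U1 : nat -> R).
Hypotheses (Lpos : forall i, [/\ 0 < L1 i, 0 < L2 i & 0 < L3 i])
  (Upos : forall i, [/\ 0 < D i, 0 < U2 i & 0 < U1 i])
  (TE : forall i j, iaddmx T (iscalar_mx s) i j =
      imulmx (lower_bidiag L1) (imulmx (lower_bidiag L2)
        (imulmx (lower_bidiag L3) (imulmx (idiag_mx D)
          (imulmx (upper_bidiag U2) (upper_bidiag U1))))) i j).

(** The first rows of these arrays, and the first columns of those of [right_factor], serve as bases
    replacing the coordinate vectors: the corresponding resolvent entries have positive residues. *)
Definition left_factor (b : nat) : imatrix R :=
  if b is 0%N then idiag_mx (fun=> 1) else upper_bidiag U1.

Definition right_factor (a : nat) : imatrix R :=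
  match a with
  | 0%N => idiag_mx (fun=> 1)
  | 1%N => lower_bidiag L1
  | _ => mul_trunc n (lower_bidiag L1) (lower_bidiag L2)
  end.

Lemma corner_one : cr (idiag_mx (fun=> 1 : R)) = 1.
Proof. by apply/matrixP => i j; rewrite !mxE /idiag_mx -val_eqE; case: eqP. Qed.

Lemma corner_PBF : cr T = cr (lower_bidiag L1) * cr (lower_bidiag L2) *
  cr (lower_bidiag L3) * cr (idiag_mx D) * cr (upper_bidiag U2) *
  cr (upper_bidiag U1) - s%:M.
Proof.
have -> : cr T = cr (iaddmx T (iscalar_mx s)) - s%:M.
  apply/matrixP => i j; rewrite !mxE /iaddmx /iscalar_mx -val_eqE /=.
  by case: eqP; rewrite ?mulr1n ?mulr0n ?addr0 ?subr0 // addrK.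
congr (_ - _); transitivity (cr (imulmx (lower_bidiag L1) (imulmx (lower_bidiag L2)
        (imulmx (lower_bidiag L3) (imulmx (idiag_mx D)
          (imulmx (upper_bidiag U2) (upper_bidiag U1))))))).
  by apply/matrixP => i j; rewrite !mxE TE.
rewrite corner_imulmx_lower; last exact: lower_bidiag_tri.
rewrite corner_imulmx_lower; last exact: lower_bidiag_tri.
rewrite corner_imulmx_lower; last exact: lower_bidiag_tri.
rewrite corner_imulmx_lower; last exact: idiag_mx_tri.
rewrite corner_imulmx_upper; last exact: upper_bidiag_tri.
by rewrite -!mulmxE !mulmxA.
Qed.

Lemma PBF_sqr_form_gt0 (b a : nat) (p : {poly R}) : p != 0 -> (size p <= n)%N ->
  0 < (cr (left_factor b) * horner_mx (cr T) p ^+ 2 * cr (right_factor a)) 0 0.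
Proof.
move=> p0 ps.
have [fL1 fL2 fL3] : [/\ tn_factor n (lower_bidiag L1), tn_factor n (lower_bidiag L2)
    & tn_factor n (lower_bidiag L3)].
  by split; apply: tn_factor_lower => i; case: (Lpos i).
have fD : tn_factor n (idiag_mx D) by apply: tn_factor_diag => i; case: (Upos i).
have f1 : tn_factor n (idiag_mx (fun=> 1 : R)) by apply: tn_factor_diag.
have [fU1 fU2] : tn_factor n (upper_bidiag U1) /\ tn_factor n (upper_bidiag U2).
  by split; apply: tn_factor_upper => i; case: (Upos i).
have sU1 : superdiag_pos n (upper_bidiag U1).
  by apply: superdiag_pos_upper => i; case: (Upos i).
pose P3 := mul_trunc n (lower_bidiag L3) (idiag_mx D).
(* [P a] and [V b] collect the factors that are not moved into [right_factor a] and
   [left_factor b]. *)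
pose P a := match a with
  | 0%N => mul_trunc n (lower_bidiag L1) (mul_trunc n (lower_bidiag L2) P3)
  | 1%N => mul_trunc n (lower_bidiag L2) P3 | _ => P3 end.
pose V b := if b is 0%N then mul_trunc n (upper_bidiag U2) (upper_bidiag U1)
            else upper_bidiag U2.
have sP3 : superfactor n (fun i j => P3 j i).
  rewrite mul_trunc_tr; apply: superfactor_mull; first exact: tn_factor_tr.
  split; first exact: tn_factor_tr.
  rewrite (_ : (fun i j => _) = upper_bidiag L3) ?upper_bidiagE //.
  by rewrite -upper_bidiagE; apply: superdiag_pos_upper => i; case: (Lpos i).
have fP3 : tn_factor n P3 by exact: tn_factor_mul.
pose q := p \Po ('X - s%:P).
have sq : size q = size p by apply: size_comp_poly2; rewrite size_XsubC.
have -> : horner_mx (cr T) p =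
  horner_mx (cr (right_factor a) * cr (P a) * cr (V b) * cr (left_factor b)) q.
  rewrite corner_PBF horner_mx_shift; congr (horner_mx _ q).
  by case: b => [|b]; case: a => [|[|a]]; rewrite /= ?corner_mul_trunc ?corner_one
    -?mulmxE ?mulr1 ?mul1r ?mul1mx ?mulmx1 ?mulmxA.
apply: sqr_form_factors_gt0; rewrite ?sq //.
- by case: b.
- by case: a => [|[|a]] //=; exact: tn_factor_mul.
- by case: a => [|[|a]] //=; repeat apply: tn_factor_mul.
- by case: b => [|b] //; exact: tn_factor_mul.
- case: b => [|b]; [right|by left].
  have [] // : superfactor n (mul_trunc n (upper_bidiag U2) (upper_bidiag U1)).
  by apply: superfactor_mull => //; split.
- case: a => [|[|a]] /=; last by case: sP3.
    rewrite !mul_trunc_tr; apply: (proj2 (_ : superfactor _ _)).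
    apply: superfactor_mulr; last exact: tn_factor_tr.
    apply: superfactor_mulr; last exact: tn_factor_tr.
    by rewrite -mul_trunc_tr.
  rewrite mul_trunc_tr; apply: (proj2 (_ : superfactor _ _)).
  by apply: superfactor_mulr => //; exact: tn_factor_tr.
- by rewrite -size_poly_eq0 sq size_poly_eq0.
Qed.

End PBFTruncation.

(** * Partial fractions of the Weyl functions *)

Section PartialFractions.
Variables (R : realType) (T : imatrix R).
Local Notation toC := (real_complex R).

Definition weyl_coef (nu : 'M[R]_3) (xi : 'M[R]_2) N (M : 'M[R]_N.+1) : 'M[R]_(2, 3) :=
  invmx xi *m E_ _ 2 N.+1 *m M *m (E_ _ 3 N.+1)^T *m (invmx nu)^T.

Lemma weyl_coef_sum nu xi N (rs : seq R) (c : R -> R) (M : R -> 'M[R]_N.+1) :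
  weyl_coef nu xi (\sum_(r <- rs) c r *: M r) =
  \sum_(r <- rs) c r *: weyl_coef nu xi (M r).
Proof.
rewrite /weyl_coef mulmx_sumr !mulmx_suml; apply: eq_bigr => r _.
by rewrite -scalemxAr -!scalemxAl.
Qed.

Lemma det_zsubT N z : \det (zsubT T N z) = (map_poly toC (P_ T N.+1)).[z].
Proof.
rewrite /P_ map_char_poly -/(horner_eval z _) /char_poly -det_map_mx.
congr (\det _); apply/matrixP => i j; rewrite !mxE /horner_eval.
by rewrite [RHS]hornerD hornerN hornerMn hornerX hornerC.
Qed.

Lemma P1_div_P_eq_S nu xi N z : zsubT T N z \in unitmx ->
  P1_div_P T nu xi N z = S_ T nu xi N z.
Proof.
move=> u; rewrite /P1_div_P /P1 /S_ /invmx u det_zsubT.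
by rewrite -scalemxAr -!scalemxAl.
Qed.

Lemma S_spectral nu xi N (rs : seq R) z : uniq rs ->
  P_ T N.+1 = \prod_(r <- rs) ('X - r%:P) -> (forall r, r \in rs -> z != toC r) ->
  zsubT T N z \in unitmx /\
  S_ T nu xi N z = \sum_(r <- rs) (z - toC r)^-1 *:
    map_mx toC (weyl_coef nu xi (spectral_proj (corner N.+1 N.+1 T) rs r)).
Proof.
move=> urs chiE zrs.
have res := resolvent_spectral_sum urs chiE (f := toC) zrs.
have [u _] := mulmx1_unit res; split; first exact: u.
have -> : S_ T nu xi N z = map_mx toC (invmx xi) *m E_ _ 2 N.+1 *m
   (\sum_(r <- rs) (z - toC r)^-1 *: map_mx toC (spectral_proj (corner N.+1 N.+1 T) rs r))
    *m (E_ _ 3 N.+1)^T *m map_mx toC (invmx nu)^T.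
  rewrite /S_; congr (_ *m _ *m _ *m _).
  by rewrite -[RHS](mulKmx u) [X in _ *m X]res mulmx1.
rewrite mulmx_sumr !mulmx_suml; apply: eq_bigr => r _.
rewrite -scalemxAr -!scalemxAl; congr (_ *: _).
by rewrite /weyl_coef !map_mxM /E_ /= !tr_pid_mx !map_pid_mx.
Qed.

(** The corner entry sees only row 0 of the left and column 0 of the right factor, so each can be
    traded for a row or column of a rectangular matrix. *)
Lemma row_col_form N p q (U E L : 'M[R]_N.+1) (A : 'M[R]_(p, N.+1))
    (B : 'M[R]_(N.+1, q)) b a :
  (forall i, U 0 i = A b i) -> (forall j, L j 0 = B j a) ->
  (U * E * L) 0 0 = (A *m E *m B) b a.
Proof.
move=> UA LB; rewrite !mxE; apply: eq_bigr => j _; rewrite LB !mxE; congr (_ * _).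
by apply: eq_bigr => i _; rewrite UA.
Qed.

(** In the bases given by the rows of [M] and the columns of [K] the residues are entrywise
    nonnegative and sum to [G0], which is free of [N]. Changing back to the original bases costs the
    entrywise absolute values of [X] and [Y], so the total variation is bounded independently of
    [N]. *)
Lemma PBF_weyl_bound nu xi s : has_PBF (iaddmx T (iscalar_mx s)) ->
  exists C : 'M[R]_(2, 3), forall N, (2 <= N)%N ->
  exists2 rs : seq R, uniq rs /\ P_ T N.+1 = \prod_(r <- rs) ('X - r%:P) &
    forall b a, \sum_(r <- rs)
      `|weyl_coef nu xi (spectral_proj (corner N.+1 N.+1 T) rs r) b a| <= C b a.
Proof.
move=> [_ [L1 [L2 [L3 [D [U2 [U1 [Lpos [Upos TE]]]]]]]]].
pose M : 'M[R]_2 := \matrix_(b, c) left_factor U1 b 0%N c.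
pose K : 'M[R]_3 := \matrix_(d, a) right_factor 2 L1 L2 a d 0%N.
have U0 : U1 0%N != 0 by case: (Upos 0%N) => _ _ /lt0r_neq0.
have Mu : M \in unitmx.
  rewrite unitmxE det_trig; last first.
    apply/is_trig_mxP => i j ij; rewrite mxE.
    by case: i j ij => [[|[|i]] iP] // [[|[|j]] jP].
  by rewrite !big_ord_recl big_ord0 !mxE /= /idiag_mx /upper_bidiag /= mul1r mulr1 unitfE.
(* The first column does not depend on the truncation once it has size at least 3, so a single [K]
   serves every [N]. *)
have K2 (m i : nat) : (2 <= m)%N ->
    right_factor m L1 L2 2 i 0%N = [:: 1; L1 0%N + L2 0%N; L1 1%N * L2 0%N]`_i.
  case: m => [|[|m]] // _.
  rewrite /= /mul_trunc !big_ord_recl big1 => [|k _]; last first.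
    by rewrite /lower_bidiag /= !mulr0.
  rewrite /lower_bidiag /=.
  by case: i => [|[|[|i]]] /=;
    rewrite ?(mul1r, mul0r, mulr0, mulr1, addr0, add0r) ?nth_nil // addrC.
have Ku : K \in unitmx.
  rewrite unitmxE -det_tr det_trig; last first.
    apply/is_trig_mxP => i j ij; rewrite !mxE.
    by case: i j ij => [[|[|[|i]]] iP] // [[|[|[|j]]] jP].
  rewrite !big_ord_recl big_ord0 !mxE K2 //= /idiag_mx /lower_bidiag /= mul1r mulr1.
  have [l10 _ _] := Lpos 0%N; have [l11 _ _] := Lpos 1%N; have [_ l20 _] := Lpos 0%N.
  by rewrite unitfE !mulf_neq0 ?lt0r_neq0.
pose X := invmx xi *m invmx M; pose Y := invmx K *m (invmx nu)^T.
pose G0 : 'M[R]_(2, 3) := M *m pid_mx 2 *m K.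
exists (map_mx Num.norm X *m G0 *m map_mx Num.norm Y) => N N2.
have [rs urs chiE] : exists2 rs, uniq rs &
    P_ T N.+1 = \prod_(r <- rs) ('X - r%:P).
  apply: char_poly_real_simple => p p0 ps.
  have := PBF_sqr_form_gt0 Lpos Upos TE 0 0 p0 ps.
  by rewrite /= !corner_one mul1r mulr1.
exists rs => // b a.
pose E := spectral_proj (corner N.+1 N.+1 T) rs.
pose G r : 'M[R]_(2, 3) := M *m E_ _ 2 N.+1 *m E r *m (E_ _ 3 N.+1)^T *m K.
have G_ge0 r c d : r \in rs -> 0 <= G r c d.
  move=> rin.
  have := PBF_sqr_form_gt0 Lpos Upos TE c d (lagrange_basis_poly_neq0 rs r)
    (size_lagrange_basis_poly urs chiE rin).
  rewrite -/(spectral_proj _ _ _) (spectral_proj_idem urs chiE) //.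
  suff -> : (corner N.+1 N.+1 (left_factor U1 c) * spectral_proj (corner N.+1 N.+1 T) rs r *
    corner N.+1 N.+1 (right_factor N L1 L2 d)) 0 0 = G r c d by move/ltW.
  rewrite /G -[RHS](_ : (M *m E_ _ 2 N.+1 *m E r *m ((E_ _ 3 N.+1)^T *m K)) c d = _);
    last by rewrite !mulmxA.
  apply: row_col_form => [i|i]; rewrite !mxE !big_ord_recl big_ord0 !mxE /= !addr0.
  - by case: c i => [[|[|c]] cP] // [[|[|i]] iP] //=;
      rewrite ?(mulr0, mulr1, addr0, add0r).
  - case: d => [[|[|[|d]]] dP] //; rewrite ?K2 //;
      case: i => [[|[|[|i]]] iP] //=; rewrite /= ?nth_nil ?(mul1r, mul0r, addr0, add0r) //.
have GE r : weyl_coef nu xi (E r) = X *m G r *m Y.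
  rewrite /X /Y /G !mulmxA (mulmxKV Mu) /weyl_coef.
  by rewrite -!mulmxA (mulKVmx Ku).
(* The projections sum to the identity, and the truncation disappears from the total mass. *)
have sumG : \sum_(r <- rs) G r = G0.
  rewrite /G -!mulmx_suml -!mulmx_sumr sum_spectral_proj // mulmx1.
  rewrite /G0 /E_ tr_pid_mx -!mulmxA; congr (_ *m _); rewrite mulmxA mul_pid_mx.
  by congr (pid_mx _ *m _); lia.
rewrite -sumG mulmx_sumr mulmx_suml summxE.
rewrite big_seq [leRHS]big_seq; apply: ler_sum => r rin.
rewrite GE 2!mxE; apply: le_trans (ler_norm_sum _ _ _) _; apply: ler_sum => d _.
rewrite normrM [map_mx _ _ _ _]mxE ler_wpM2r // !mxE.
apply: le_trans (ler_norm_sum _ _ _) _; apply: ler_sum => c _.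
by rewrite normrM [map_mx _ _ _ _]mxE (ger0_norm (G_ge0 _ _ _ rin)).
Qed.

End PartialFractions.

(** * The interval Delta *)

Section Zeros.
Variable R : realType.
Implicit Types (T : imatrix R) (x : nat -> R).

Lemma l2normE x : l2norm x = ((\sum_(0 <= k <oo) (x k ^+ 2)%:E) `^ 2^-1)%E.
Proof.
rewrite /l2norm Lnorm_counting //; congr ((_ `^ _)%E).
apply: eq_eseriesr => k _ /=.
by rewrite powR_mulrn ?normr_ge0 // real_normK ?num_real.
Qed.

Lemma l2norm_ge n x : ((Num.sqrt (\sum_(k < n) x k ^+ 2))%:E <= l2norm x)%E.
Proof.
have x2 k : (0 <= (x k ^+ 2)%:E)%E by rewrite lee_fin sqr_ge0.
rewrite l2normE -[X in (X <= _)%E]/(sqrte (\sum_(k < n) x k ^+ 2)%:E).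
rewrite -poweR12_sqrt; last by rewrite lee_fin sumr_ge0 // => k _; rewrite sqr_ge0.
apply: gt0_ler_poweR; rewrite ?invr_ge0 // ?in_itv /= ?andbT ?leey ?nneseries_ge0 //.
  by rewrite lee_fin sumr_ge0 // => k _; rewrite sqr_ge0.
rewrite -sumEFin -(big_mkord xpredT (fun k => (x k ^+ 2)%:E)).
exact: nneseries_lim_ge.
Qed.

Lemma l2norm_finsupp n x : (forall k, (n <= k)%N -> x k = 0) ->
  l2norm x = (Num.sqrt (\sum_(k < n) x k ^+ 2))%:E.
Proof.
move=> x0; have x2 k : (0 <= (x k ^+ 2)%:E)%E by rewrite lee_fin sqr_ge0.
rewrite l2normE -[RHS]/(sqrte (\sum_(k < n) x k ^+ 2)%:E) -poweR12_sqrt; last first.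
  by rewrite lee_fin sumr_ge0 // => k _; rewrite sqr_ge0.
rewrite (@nneseries_split _ _ 0 n) // add0n eseries0 ?adde0; last first.
  by move=> k nk _; rewrite x0 // expr0n.
by rewrite sumEFin big_mkord.
Qed.

(** An eigenvector of the truncation, extended by zero to [y], satisfies (T y)_i = r y_i for i up to
    N; hence |r| times the norm of [y] is at most the norm of T y. *)
Lemma zeros_bounded T : bounded_operator T -> exists M : R, forall r, zeros T r -> `|r| <= M.
Proof.
move=> [M TM]; exists M => r [N rr].
(* Eigenvectors are row vectors here; the transpose makes [w] a column eigenvector of the
   truncation. *)
have /eigenvalueP [w wE w0] : eigenvalue (corner N.+1 N.+1 T)^T r.
  rewrite eigenvalue_root_char (_ : char_poly _ = P_ T N.+1) // /P_ /char_poly.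
  by rewrite -[RHS]det_tr; congr (\det _); apply/matrixP => i j; rewrite !mxE eq_sym.
pose y k := if insub k is Some i then w 0 (i : 'I_N.+1) else 0.
have yE (i : 'I_N.+1) : y i = w 0 i by rewrite /y valK.
have y0 k : (N.+1 <= k)%N -> y k = 0 by move=> nk; rewrite /y insubN // -leqNgt.
have TyE (i : 'I_N.+1) : iapply T y i = r * y i.
  rewrite /iapply (@fsbig_setT_ord _ N.+1); last by move=> k /y0 ->; rewrite mulr0.
  have := congr1 (fun v : 'rV__ => v 0 i) wE; rewrite !mxE yE => <-.
  by apply: eq_bigr => k _; rewrite !mxE yE mulrC.
have S0 : 0 < \sum_(k < N.+1) y k ^+ 2.
  rewrite lt0r sumr_ge0 ?andbT; last by move=> k _; rewrite sqr_ge0.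
  apply: contra w0; rewrite psumr_eq0 => [/allP h|k _]; last exact: sqr_ge0.
  apply/eqP/rowP => i; rewrite mxE -yE.
  by apply/eqP; have := h i (mem_index_enum _); rewrite sqrf_eq0.
have := TM y; rewrite (l2norm_finsupp y0) ltry => /(_ isT) /(le_trans (l2norm_ge N.+1 _)).
rewrite -EFinM lee_fin; under eq_bigr => k _ do rewrite TyE exprMn.
by rewrite -mulr_sumr sqrtrM ?sqr_ge0 // sqrtr_sqr ler_pM2r // sqrtr_gt0.
Qed.

End Zeros.

Section DeltaFacts.
Variables (R : realType) (T : imatrix R).

Lemma zeros_sub_Delta : zeros T `<=` Delta T.
Proof. by move=> x zx I [_ _]; apply. Qed.

Lemma closed_Delta : closed (Delta T).
Proof. by apply: closed_bigI => I []. Qed.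

Lemma is_interval_Delta : is_interval (Delta T).
Proof.
move=> x y Dx Dy z xzy I hI; have [_ iI _] := hI.
exact: (iI x y (Dx _ hI) (Dy _ hI)).
Qed.

Lemma measurable_Delta : measurable (Delta T).
Proof. by apply: closed_measurable; exact: closed_Delta. Qed.

Lemma Delta_bounded : bounded_operator T ->
  exists2 M : R, 0 <= M & forall x, Delta T x -> `|x| <= M.
Proof.
move=> /zeros_bounded [M hM]; exists (Num.max M 0); first by rewrite le_max lexx orbT.
move=> x Dx; apply: (Dx [set x | `|x| <= Num.max M 0]); split.
- rewrite (_ : [set _ | _] = `[- Num.max M 0, Num.max M 0]%classic); first exact: itv_closed.
  by apply/seteqP; split => y /=; rewrite in_itv /= ler_norml.
- move=> y z /=; rewrite !ler_norml => /andP [ya yb] /andP [za zb] w /andP [yw wz].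
  by rewrite ler_norml (le_trans ya yw) (le_trans wz zb).
- by move=> y /hM /= yM; rewrite le_max yM.
Qed.

End DeltaFacts.

(** * Integration against signed measures *)

Section ChargeIntegral.
Variables (R : realType) (m : {charge set R -> \bar R}) (D : set R).
Hypothesis mD : measurable D.

Definition bounded_meas (f : R -> R) :=
  measurable_fun D f /\ exists B, forall x, D x -> `|f x| <= B.

Lemma bounded_measD f g : bounded_meas f -> bounded_meas g ->
  bounded_meas (fun x => f x + g x).
Proof.
move=> [mf [B fB]] [mg [B' gB]]; split; first exact: measurable_funD.
by exists (B + B') => x Dx; rewrite (le_trans (ler_normD _ _)) // lerD ?fB ?gB.
Qed.

Lemma bounded_measZ a f : bounded_meas f -> bounded_meas (fun x => a * f x).
Proof.
move=> [mf [B fB]]; split; first exact: measurable_funM.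
by exists (`|a| * B) => x Dx; rewrite normrM ler_wpM2l ?fB.
Qed.

Lemma bounded_meas_integrable (mu : {finite_measure set R -> \bar R}) f :
  bounded_meas f -> mu.-integrable D (EFin \o f).
Proof.
move=> [mf [B fB]]; apply: measurable_bounded_integrable => //.
  by rewrite (le_lt_trans (le_measure mu _ _ (@subsetT _ D))) ?inE // fin_num_fun_lty //;
    exact: fin_num_measure.
exists B; split; first exact: num_real.
by move=> y By x Dx; apply: le_trans (fB x Dx) (ltW By).
Qed.

Lemma charge_integralD f g : bounded_meas f -> bounded_meas g ->
  charge_integral m D (fun x => f x + g x) =
  charge_integral m D f + charge_integral m D g.
Proof.
move=> bf bg; rewrite /charge_integral.
rewrite !RintegralD //; try exact: bounded_meas_integrable.
by ring.
Qed.

Lemma charge_integralZ a f : bounded_meas f ->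
  charge_integral m D (fun x => a * f x) = a * charge_integral m D f.
Proof.
move=> bf; rewrite /charge_integral.
by rewrite !RintegralZl //; try exact: bounded_meas_integrable; rewrite mulrBr.
Qed.

(** The constant is the sum of the masses on [D] of the two Jordan parts. *)
Lemma charge_integral_le : exists2 V : R, 0 <= V & forall (f : R -> R) (B : R),
  measurable_fun D f -> (forall x, D x -> `|f x| <= B) ->
  `|charge_integral m D f| <= V * B.
Proof.
rewrite /charge_integral.
set mp := jordan_pos _; set mn := jordan_neg _.
exists (fine (mp D) + fine (mn D)); first by rewrite addr_ge0 // fine_ge0.
move=> f B mf fB.
have bf : bounded_meas f by split => //; exists B.
have bound (mu : {finite_measure set R -> \bar R}) :
    `|\int[mu]_(x in D) f x| <= fine (mu D) * B.
  have iF := bounded_meas_integrable mu bf.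
  apply: le_trans (le_normr_Rintegral mD iF) _.
  rewrite mulrC -Rintegral_cst //; apply: le_Rintegral => //.
  - apply: bounded_meas_integrable; split; last by exists B => x /fB; rewrite normr_id.
    exact: measurableT_comp.
  - by apply: bounded_meas_integrable; split => //; exists `|B|.
by rewrite (le_trans (ler_normB _ _)) // mulrDl lerD // bound.
Qed.

End ChargeIntegral.

(** * Stieltjes transforms *)

Section ComplexParts.
Variable R : realType.
Implicit Types u v : R[i].
Local Notation Re := (@complex.Re R).
Local Notation Im := (@complex.Im R).

Lemma complexReD u v : Re (u + v) = Re u + Re v.
Proof. by case: u => a b; case: v => c d. Qed.

Lemma complexImD u v : Im (u + v) = Im u + Im v.
Proof. by case: u => a b; case: v => c d. Qed.

(** The difference is written as a sum of two real multiples, so that additivity and homogeneity of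
    the integral apply directly. *)
Lemma complexReM u v : Re (u * v) = Re u * Re v + - Im u * Im v.
Proof. by case: u => a b; case: v => c d /=; rewrite mulNr. Qed.

Lemma complexImM u v : Im (u * v) = Re u * Im v + Im u * Re v.
Proof. by case: u => a b; case: v => c d. Qed.

Lemma norm_real_complex (x : R) : `|real_complex R x| = real_complex R `|x|.
Proof. by rewrite normc_def /= expr0n /= addr0 sqrtr_sqr. Qed.

Lemma normc_le_Re_Im u : `|u| <= real_complex R (`|Re u| + `|Im u|).
Proof.
rewrite normc_def lecR -[leRHS]ger0_norm ?addr_ge0 // -sqrtr_sqr ler_wsqrtr //.
rewrite sqrrD !real_normK ?num_real // lerD2r lerDl.
by rewrite mulrn_wge0 // mulr_ge0.
Qed.

Lemma normc_Re_le u (e : R) : `|u| <= real_complex R e -> `|Re u| <= e.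
Proof.
rewrite normc_def lecR => /(le_trans _); apply.
by rewrite -sqrtr_sqr ler_wsqrtr // lerDl sqr_ge0.
Qed.

Lemma normc_Im_le u (e : R) : `|u| <= real_complex R e -> `|Im u| <= e.
Proof.
rewrite normc_def lecR => /(le_trans _); apply.
by rewrite -sqrtr_sqr ler_wsqrtr // lerDr sqr_ge0.
Qed.

End ComplexParts.

Section ComplexChargeIntegral.
Variables (R : realType) (m : {charge set R -> \bar R}) (D : set R).
Hypothesis mD : measurable D.
Local Notation toC := (real_complex R).
Implicit Types f g : R -> R[i].

Definition cbounded_meas f :=
  bounded_meas D (fun x => complex.Re (f x)) /\
  bounded_meas D (fun x => complex.Im (f x)).

Lemma cbounded_measD f g : cbounded_meas f -> cbounded_meas g ->
  cbounded_meas (fun x => f x + g x).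
Proof.
move=> [rf jf] [rg jg]; split; under eq_fun do rewrite ?complexReD ?complexImD;
  exact: bounded_measD.
Qed.

Lemma cbounded_measZ a f : cbounded_meas f -> cbounded_meas (fun x => a * f x).
Proof.
move=> [rf jf]; split; under eq_fun do rewrite ?complexReM ?complexImM;
  by apply: bounded_measD => //; exact: bounded_measZ.
Qed.

Lemma Ccharge_integralD f g : cbounded_meas f -> cbounded_meas g ->
  Ccharge_integral m D (fun x => f x + g x) =
  Ccharge_integral m D f + Ccharge_integral m D g.
Proof.
move=> [rf jf] [rg jg]; rewrite /Ccharge_integral.
under eq_fun do rewrite complexReD; under [X in Complex _ (_ X)]eq_fun do rewrite complexImD.
by rewrite !charge_integralD.
Qed.

Lemma Ccharge_integralZ a f : cbounded_meas f ->
  Ccharge_integral m D (fun x => a * f x) = a * Ccharge_integral m D f.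
Proof.
move=> [rf jf]; rewrite /Ccharge_integral.
under eq_fun do rewrite complexReM; under [X in Complex _ (_ X)]eq_fun do rewrite complexImM.
rewrite !charge_integralD ?charge_integralZ //; try exact: bounded_measZ.
by case: a => a b /=; rewrite mulNr.
Qed.

Lemma Ccharge_integral_le : exists2 V : R, 0 <= V & forall f (B : R),
  cbounded_meas f -> (forall x, D x -> `|f x| <= toC B) ->
  `|Ccharge_integral m D f| <= toC (V * B).
Proof.
have [V V0 hV] := charge_integral_le m mD; exists (V + V); first exact: addr_ge0.
move=> f B [[rf _] [jf _]] fB; apply: le_trans (normc_le_Re_Im _) _.
rewrite lecR mulrDl /= lerD // hV // => x /fB; [exact: normc_Re_le|exact: normc_Im_le].
Qed.

Hypothesis D_bounded : exists M : R, forall x, D x -> `|x| <= M.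

Lemma cbounded_meas_exp k : cbounded_meas (fun x => toC (x ^+ k)).
Proof.
have [M DM] := D_bounded; split.
  split; first by apply: measurable_funX; exact: measurable_id.
  by exists (M ^+ k) => x Dx; rewrite normrX lerXn2r ?nnegrE ?(le_trans _ (DM x Dx)) ?DM.
split; first exact: measurable_cst.
by exists 0 => x _; rewrite normr0.
Qed.

Lemma Ccharge_integral_exp k : Ccharge_integral m D (fun x => toC (x ^+ k)) =
  toC (charge_integral m D (fun x => x ^+ k)).
Proof.
rewrite /Ccharge_integral /=; congr Complex.
(* The zero function is presented as a multiple of a monomial, so that homogeneity makes its
   integral vanish. *)
have -> : (fun=> 0) = (fun x : R => 0 * x ^+ 0) by apply/funext => x; rewrite mul0r.
rewrite charge_integralZ ?mul0r //.
by have [] := cbounded_meas_exp 0.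
Qed.

Lemma cbounded_meas_poly (p : {poly R[i]}) : cbounded_meas (fun x => p.[toC x]).
Proof.
under eq_fun do rewrite horner_coef.
elim: (size p) => [|k IH].
  under eq_fun => x do rewrite big_ord0 -(mul0r (toC (x ^+ 0))).
  exact/cbounded_measZ/cbounded_meas_exp.
under eq_fun do rewrite big_ord_recr -rmorphXn /=.
by apply: cbounded_measD => //; apply: cbounded_measZ; exact: cbounded_meas_exp.
Qed.

Lemma Ccharge_integral_poly (p : {poly R[i]}) n : (size p <= n)%N ->
  Ccharge_integral m D (fun x => p.[toC x]) =
  \sum_(k < n) p`_k * toC (charge_integral m D (fun x => x ^+ k)).
Proof.
move=> pn; under eq_fun do rewrite (horner_coef_wide _ pn).
elim: n {pn} => [|k IH].
  under eq_fun => x do rewrite big_ord0 -(mul0r (toC (x ^+ 0))).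
  by rewrite Ccharge_integralZ ?big_ord0 ?mul0r //; exact: cbounded_meas_exp.
under eq_fun do rewrite big_ord_recr -rmorphXn /=.
rewrite Ccharge_integralD.
- rewrite IH big_ord_recr /=; congr (_ + _).
  rewrite Ccharge_integralZ ?Ccharge_integral_exp //; exact: cbounded_meas_exp.
- have := cbounded_meas_poly (\poly_(i < k) p`_i).
  congr (cbounded_meas _); apply/funext => x.
  rewrite (horner_coef_wide _ (size_poly _ _)); apply: eq_bigr => i _.
  by rewrite coef_poly ltn_ord.
- by apply: cbounded_measZ; exact: cbounded_meas_exp.
Qed.

End ComplexChargeIntegral.

(** * Polynomial approximation of the Cauchy kernel *)

Section CauchyKernel.
Variables (R : realType) (D : set R).
Hypothesis mD : measurable D.
Local Notation toC := (real_complex R).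

(** Partial sum of the geometric series of 1/(z - x) in powers of (x - c)/(z - c). *)
Definition kernel_poly (F : fieldType) (z c : F) (n : nat) : {poly F} :=
  \sum_(k < n) (z - c)^-1 ^+ k.+1 *: ('X - c%:P) ^+ k.

Lemma size_kernel_poly (F : fieldType) (z c : F) n : (size (kernel_poly z c n) <= n)%N.
Proof.
apply: (leq_trans (size_sum _ _ _)); apply/bigmax_leqP => k _.
by rewrite (leq_trans (size_scale_leq _ _)) // size_exp_XsubC.
Qed.

Lemma kernel_polyE (F : fieldType) (z c x : F) n : z != c -> z != x ->
  (z - x)^-1 = (kernel_poly z c n).[x] + ((x - c) / (z - c)) ^+ n / (z - x).
Proof.
rewrite -subr_eq0 -(subr_eq0 z x) => zc zx; set q := (x - c) / (z - c).
have q1 : 1 - q = (z - x) / (z - c) by rewrite /q; field.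
have -> : (kernel_poly z c n).[x] = (z - c)^-1 * \sum_(k < n) q ^+ k.
  rewrite horner_sum mulr_sumr; apply: eq_bigr => k _.
  by rewrite hornerZ horner_exp hornerXsubC exprS -mulrA /q expr_div_n exprVn (mulrC (_ ^- _)).
have -> : \sum_(k < n) q ^+ k = (1 - q ^+ n) / (1 - q).
  have q1n : 1 - q != 0 by rewrite q1 mulf_neq0 ?invr_eq0.
  by apply: (mulfI q1n); rewrite mulrCA divff // mulr1 -opprB -[in RHS]opprB subrX1 mulNr.
by rewrite q1; field; apply/andP.
Qed.

(** The distance [d] bounds the kernel by 1/d and keeps the denominator of its real and imaginary
    parts nonzero, so these are continuous on [D]. *)
Lemma cbounded_meas_kernel (z : R[i]) (d : R) : 0 < d ->
  (forall x, D x -> toC d <= `|z - toC x|) ->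
  cbounded_meas D (fun x => (z - toC x)^-1).
Proof.
move=> d0 zd.
have bound x : D x -> `|(z - toC x)^-1| <= toC d^-1.
  move=> /zd zx; have dC : 0 < toC d by rewrite ltcR.
  by rewrite normfV fmorphV lef_pV2 ?posrE // (lt_le_trans dC).
have E x : (z - toC x)^-1 = Complex
   ((complex.Re z - x) * ((complex.Re z - x) ^+ 2 + complex.Im z ^+ 2)^-1)
   (- complex.Im z * ((complex.Re z - x) ^+ 2 + complex.Im z ^+ 2)^-1).
  by case: (z) => a b /=; rewrite /GRing.inv /= subr0 mulNr.
have den x : D x -> (complex.Re z - x) ^+ 2 + complex.Im z ^+ 2 != 0.
  move=> Dx; apply: contraTneq (zd x Dx) => e.
  rewrite -real_ltNge ?normr_real ?complex_real //.
  rewrite normc_def ltcR (_ : _ + _ = 0) ?sqrtr0 //.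
  by move: e; case: (z) => a b /=; rewrite subr0.
have cre x : {for x, continuous (fun y : R => complex.Re z - y)}.
  by apply: continuousB; [exact: cst_continuous|exact: cvg_id].
pose dinv y := ((complex.Re z - y) ^+ 2 + complex.Im z ^+ 2)^-1.
have cden x : D x -> {for x, continuous dinv}.
  move=> Dx; apply: continuousV; first exact: den.
  apply: continuousD; last exact: cst_continuous.
  exact: (continuousM (cre x) (cre x)).
split; split.
- apply: subspace_continuous_measurable_fun => //; apply: continuous_in_subspaceT => x.
  rewrite inE => Dx.
  rewrite (_ : (fun _ => _) = (fun y => complex.Re z - y) \* dinv); last first.
    by apply/funext => y; rewrite E.
  by apply: continuousM; [exact: cre|exact: cden].
- by exists d^-1 => x /bound; exact: normc_Re_le.
- apply: subspace_continuous_measurable_fun => //; apply: continuous_in_subspaceT => x.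
  rewrite inE => Dx.
  rewrite (_ : (fun _ => _) = (fun y => - complex.Im z) \* dinv); last first.
    by apply/funext => y; rewrite E.
  by apply: continuousM; [exact: cst_continuous|exact: cden].
- by exists d^-1 => x /bound; exact: normc_Im_le.
Qed.

End CauchyKernel.

Section StieltjesEstimate.
Variables (R : realType) (m : {charge set R -> \bar R}) (D : set R).
Hypothesis mD : measurable D.
Hypothesis D_bounded : exists M : R, forall x, D x -> `|x| <= M.
Local Notation toC := (real_complex R).
Variables (c : R[i]) (r0 : R).
Hypothesis (r0_ge0 : 0 <= r0) (D_disc : forall x, D x -> `|toC x - c| <= toC r0).

Lemma disc_dist (z : R[i]) (r1 x : R) : toC r1 <= `|z - c| -> D x ->
  toC (r1 - r0) <= `|z - toC x|.
Proof.
move=> zr Dx; rewrite rmorphB /=; apply: le_trans (lerB zr (D_disc Dx)) _.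
rewrite lerBlDr; apply: le_trans (ler_normD _ _).
by rewrite addrA subrK.
Qed.

Lemma disc_kernel_le (z : R[i]) (r1 x : R) : r0 < r1 -> toC r1 <= `|z - c| -> D x ->
  `|(z - toC x)^-1| <= toC (r1 - r0)^-1.
Proof.
move=> r01 zr Dx; have := disc_dist zr Dx => zx.
have d0 : 0 < toC (r1 - r0) by rewrite ltcR subr_gt0.
by rewrite normfV fmorphV lef_pV2 ?posrE // (lt_le_trans d0).
Qed.

Lemma weighted_sum_le (rs : seq R) (w : R -> R) (f : R -> R[i]) (C B : R) :
  0 <= B -> (forall r, r \in rs -> `|f r| <= toC B) ->
  \sum_(r <- rs) `|w r| <= C -> `|\sum_(r <- rs) f r * toC (w r)| <= toC (C * B).
Proof.
move=> B0 fB wC; apply: le_trans (ler_norm_sum _ _ _) _.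
apply: (@le_trans _ _ (\sum_(r <- rs) toC (B * `|w r|))).
  rewrite big_seq [leRHS]big_seq; apply: ler_sum => r rin.
  by rewrite normrM norm_real_complex rmorphM ler_wpM2r ?fB // ler0c.
by rewrite -rmorph_sum lecR -mulr_sumr mulrC ler_wpM2r.
Qed.

(** Both measures integrate the polynomial [kernel_poly z c n] to the same value, because their
    moments of order below [n] agree. Only the geometric remainder is left; it is small on [D] and
    is weighted by the masses [C] and [V]. The constant [V] is independent of [z], [r1] and the
    discrete measure. *)
Lemma stieltjes_estimate : exists2 V : R, 0 <= V &
  forall (r1 : R) (z : R[i]), r0 < r1 -> toC r1 <= `|z - c| ->
  `|Ccharge_integral m D (fun x => (z - toC x)^-1)| <= toC (V * (r1 - r0)^-1) /\
  forall n (rs : seq R) (w : R -> R) (C : R),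
  (forall r, r \in rs -> D r) -> \sum_(r <- rs) `|w r| <= C ->
  (forall k, (k < n)%N ->
     \sum_(r <- rs) r ^+ k * w r = charge_integral m D (fun x => x ^+ k)) ->
  `|\sum_(r <- rs) (z - toC r)^-1 * toC (w r) -
     Ccharge_integral m D (fun x => (z - toC x)^-1)|
  <= toC ((C + V) * ((r0 / r1) ^+ n * (r1 - r0)^-1)).
Proof.
have [V V0 hV] := Ccharge_integral_le m mD; exists V => // r1 z r01 zr.
have d0 : 0 < r1 - r0 by rewrite subr_gt0.
have r1_gt0 : 0 < r1 by apply: le_lt_trans r01.
have ck : cbounded_meas D (fun x => (z - toC x)^-1).
  by apply: (cbounded_meas_kernel mD d0) => x; exact: disc_dist.
split; first by apply: hV => // x; exact: disc_kernel_le.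
move=> n rs w C rsD wC mom.
pose p := kernel_poly z c n.
pose h x := (z - toC x)^-1 + -1 * p.[toC x].
have hE x : (z - toC x)^-1 = p.[toC x] + h x by rewrite /h mulN1r addrCA subrr addr0.
have zc : z != c.
  rewrite -subr_eq0 -normr_gt0 (lt_le_trans _ zr) //.
  by rewrite ltcR.
have h_le x : D x -> `|h x| <= toC ((r0 / r1) ^+ n * (r1 - r0)^-1).
  move=> Dx; have zx : z != toC x.
    by rewrite -subr_eq0 -normr_gt0 (lt_le_trans _ (disc_dist zr Dx)) // ltcR.
  rewrite /h {1}(kernel_polyE n zc zx) mulN1r addrAC subrr add0r.
  rewrite normrM rmorphM /= ler_pM //; last exact: disc_kernel_le.
  rewrite normrX rmorphXn /= lerXn2r ?nnegrE //.
    by rewrite ler0c divr_ge0 // ltW.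
  rewrite normrM normfV rmorphM fmorphV /= ler_pM ?invr_ge0 // ?D_disc //.
  by rewrite lef_pV2 ?posrE ?(lt_le_trans _ zr) ?ltcR.
have cp := cbounded_meas_poly D_bounded p.
have ch : cbounded_meas D h.
  by apply: cbounded_measD => //; apply: cbounded_measZ.
have -> : Ccharge_integral m D (fun x => (z - toC x)^-1) =
    Ccharge_integral m D (fun x => p.[toC x]) + Ccharge_integral m D h.
  by rewrite -Ccharge_integralD //; congr (Ccharge_integral _ _ _); apply/funext.
have -> : Ccharge_integral m D (fun x => p.[toC x]) =
    \sum_(r <- rs) p.[toC r] * toC (w r).
  rewrite (Ccharge_integral_poly m mD D_bounded (size_kernel_poly z c n)).
  under [RHS]eq_bigr => r _ do rewrite (horner_coef_wide _ (size_kernel_poly z c n)) mulr_suml.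
  rewrite exchange_big /=; apply: eq_bigr => k _.
  rewrite -mom // rmorph_sum mulr_sumr; apply: eq_bigr => r _.
  by rewrite rmorphM rmorphXn mulrA.
rewrite opprD addrA -sumrB.
under eq_bigr => r _ do rewrite hE mulrDl addrAC subrr add0r.
have B0 : 0 <= (r0 / r1) ^+ n * (r1 - r0)^-1.
  by rewrite mulr_ge0 ?exprn_ge0 ?divr_ge0 ?invr_ge0 // ltW.
rewrite mulrDl rmorphD; apply: le_trans (ler_normB _ _) _; apply: lerD; last exact: hV.
by apply: weighted_sum_le => // r /rsD; exact: h_le.
Qed.

End StieltjesEstimate.

(** * Uniform bounds for the Weyl functions *)

Section WeylEstimate.
Variables (R : realType) (T : imatrix R) (nu : 'M[R]_3) (xi : 'M[R]_2).
Variable psi : 'I_2 -> 'I_3 -> {charge set R -> \bar R}.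
Hypotheses (T_banded : banded T) (T_bounded : bounded_operator T)
  (T_PBF : exists s : R, 0 <= s /\ has_PBF (iaddmx T (iscalar_mx s)))
  (psi_spectral : spectral_matrix T nu xi psi).
Local Notation toC := (real_complex R).

(** The bound on [N] leaves room for [k] steps of length at most 2 from rows 0 and 1, and for column
    2. *)
Lemma corner_E_iexpmx N k : (2 * k + 2 <= N)%N ->
  E_ R 2 N.+1 *m corner N.+1 N.+1 T ^+ k *m (E_ R 3 N.+1)^T = corner 2 3 (iexpmx T k).
Proof.
move=> kN; set M := _ ^+ k; apply/matrixP => i j.
have iN : (i <= N)%N by have := ltn_ord i; lia.
have jN : (j <= N)%N by have := ltn_ord j; lia.
rewrite [RHS]mxE (@iexpmx_trunc _ _ N) //; last by have := ltn_ord i; lia.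
have EE r (k' : 'I_r) l : (k' <= N)%N -> E_ R r N.+1 k' l = (l == inord k')%:R.
  move=> k'N; rewrite mxE ltn_ord andbT -(inj_eq val_inj) /= inordK //.
  by rewrite eq_sym.
rewrite -/M mxE (bigD1 (inord j)) //= big1 ?addr0; last first.
  by move=> l /negbTE lj; rewrite [X in _ * X]mxE EE // lj mulr0.
rewrite [X in _ * X]mxE EE // eqxx mulr1 mxE (bigD1 (inord i)) //= big1 ?addr0.
  by rewrite EE // eqxx mul1r.
by move=> l /negbTE li; rewrite EE // li mul0r.
Qed.

Variables (c : R[i]) (r0 : R).
Hypothesis (r0_ge0 : 0 <= r0) (Delta_disc : forall x, Delta T x -> `|toC x - c| <= toC r0).

Lemma weyl_estimate : exists2 K : R, 0 <= K &
  forall (r1 : R) (z : R[i]), r0 < r1 -> toC r1 <= `|z - c| -> forall b a,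
  `|psi_hat T psi z b a| <= toC (K * (r1 - r0)^-1) /\
  forall N, (2 <= N)%N ->
  [/\ P1_div_P T nu xi N z = S_ T nu xi N z,
      `|S_ T nu xi N z b a| <= toC (K * (r1 - r0)^-1) &
      forall n, (2 * n + 2 <= N)%N ->
      `|S_ T nu xi N z b a - psi_hat T psi z b a|
        <= toC (K * ((r0 / r1) ^+ n * (r1 - r0)^-1))].
Proof.
have [s [_ pbf]] := T_PBF; have [C hC] := PBF_weyl_bound nu xi pbf.
have mD := measurable_Delta T.
have [M0 M0_ge0 DM0] := Delta_bounded T_bounded.
have D_bd : exists M : R, forall x, Delta T x -> `|x| <= M by exists M0.
pose V b a := cid2 (stieltjes_estimate (psi b a) mD D_bd r0_ge0 Delta_disc).
have V0 b a : 0 <= s2val (V b a) := s2valP (V b a).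
have C0 b a : 0 <= C b a.
  have [rs _ /(_ b a)] := hC 2%N isT; apply: le_trans.
  by rewrite sumr_ge0.
(* The sum of the nonnegative constants of all six entries dominates each of them. *)
pose K := \sum_b \sum_a (C b a + s2val (V b a)).
have KE b a : C b a + s2val (V b a) <= K.
  rewrite /K (bigD1 b) //= (bigD1 a) //= -addrA lerDl addr_ge0 //.
    by rewrite sumr_ge0 // => a' _; rewrite addr_ge0.
  by rewrite sumr_ge0 // => b' _; rewrite sumr_ge0 // => a' _; rewrite addr_ge0.
have K0 : 0 <= K by apply: le_trans (KE ord0 ord0); rewrite addr_ge0.
exists K => // r1 z r01 zr b a.
have d0 : 0 <= (r1 - r0)^-1 by rewrite invr_ge0 subr_ge0 ltW.
have r1_gt0 : 0 < r1 by apply: le_lt_trans r01.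
have [psi_le est] := s2valP' (V b a) r1 z r01 zr.
split.
  rewrite mxE; apply: le_trans psi_le _; rewrite lecR ler_wpM2r //.
  by apply: le_trans (KE b a); rewrite lerDr.
move=> N N2; have [rs [urs chiE] rsC] := hC N N2.
have rsD r : r \in rs -> Delta T r.
  by move=> rin; apply: zeros_sub_Delta; exists N; rewrite chiE root_prod_XsubC.
have zrs r : r \in rs -> z != toC r.
  move=> /rsD /(disc_dist Delta_disc zr) h; rewrite -subr_eq0 -normr_gt0.
  by apply: lt_le_trans h; rewrite ltcR subr_gt0.
have [u SE] := S_spectral nu xi urs chiE zrs.
pose w r := weyl_coef nu xi (spectral_proj (corner N.+1 N.+1 T) rs r) b a.
have SEba : S_ T nu xi N z b a = \sum_(r <- rs) (z - toC r)^-1 * toC (w r).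
  by rewrite SE summxE; apply: eq_bigr => r _; rewrite mxE [X in _ * X]mxE.
split; first exact: P1_div_P_eq_S.
- rewrite SEba; apply: (@le_trans _ _ (toC (C b a * (r1 - r0)^-1))); last first.
    by rewrite lecR ler_wpM2r // (le_trans _ (KE b a)) // lerDl.
  apply: weighted_sum_le => // [r /rsD|]; last exact: rsC.
  by move=> Dr; apply: (disc_kernel_le Delta_disc r01 zr Dr).
- move=> n nN; rewrite SEba mxE.
  apply: (le_trans (est n rs w (C b a) rsD (rsC b a) _)); last first.
    rewrite lecR ler_wpM2r ?KE //.
    by rewrite mulr_ge0 ?exprn_ge0 ?divr_ge0 // ltW.
  (* The discrete moments are entries of the [k]-th power of the truncation, which for these [k] has
     the same corner as the power of [T]. *)
  move=> k kn; have [_ /(_ k) /matrixP /(_ b a)] := psi_spectral.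
  rewrite mxE => ->; rewrite -(@corner_E_iexpmx N); last lia.
  rewrite !mulmxA -/(weyl_coef nu xi _) (exp_spectral_sum urs chiE) weyl_coef_sum summxE.
  by apply: eq_bigr => r _; rewrite mxE.
Qed.

End WeylEstimate.

(** * The Riemann sphere *)

Section Sphere.
Variable R : realType.
Local Notation toC := (real_complex R).
Implicit Types (z c : R[i]) (D : set R).

Lemma norm_complexE z : exists2 r : R, 0 <= r & `|z| = toC r.
Proof.
exists (Num.sqrt (complex.Re z ^+ 2 + complex.Im z ^+ 2)); first exact: sqrtr_ge0.
exact: normc_def.
Qed.

Lemma complex_gt0E (e : R[i]) : 0 < e -> exists2 r : R, 0 < r & e = toC r.
Proof. by case: e => a b; rewrite ltcE /= => /andP [/eqP -> a0]; exists a. Qed.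

(** For a nonreal point the disc is centred far on the opposite side of the real axis; for a real
    point outside the interval, far on the side where the interval lies. *)
Lemma separating_disc D z0 (M : R) : closed D -> is_interval D ->
  0 <= M -> (forall x, D x -> `|x| <= M) -> ~ (exists2 x, D x & z0 = toC x) ->
  exists c : R[i], exists r0 r1 : R, [/\ 0 <= r0, r0 < r1,
    forall x, D x -> `|toC x - c| <= toC r0 & toC r1 < `|z0 - c| ].
Proof.
move=> cD iD M0 DM nz0.
suff [c [r0 [r00 Dc zc]]] : exists c : R[i], exists r0 : R, [/\ 0 <= r0,
    forall x, D x -> `|toC x - c| <= toC r0 & toC r0 < `|z0 - c| ].
  have [r _ e] := norm_complexE (z0 - c); rewrite e ltcR in zc.
  exists c, r0, ((r0 + r) / 2%:R); split => //; first lra.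
  by rewrite e ltcR; lra.
have [b0|b0] := eqVneq (complex.Im z0) 0; last first.
  (* With 2 k b^2 = M^2, the squared distance from [z0] to the centre exceeds the squared radius by
     a^2 + b^2. *)
  pose a := complex.Re z0; pose b := complex.Im z0; pose k := M ^+ 2 / (2%:R * b ^+ 2).
  have bb : 0 < b ^+ 2 by rewrite exprn_even_gt0.
  have kb : k * b ^+ 2 *+ 2 = M ^+ 2 by rewrite /k mulr2n; field.
  exists (Complex 0 (- (k * b))), (Num.sqrt (M ^+ 2 + (k * b) ^+ 2)); split.
  - exact: sqrtr_ge0.
  - move=> x Dx; rewrite normc_def lecR ler_wsqrtr //= subr0 sub0r opprK lerD2r.
    by rewrite -(real_normK (num_real x)) lerXn2r ?nnegrE ?DM.
  - have -> : z0 = Complex a b by rewrite /a /b; case: (z0).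
    rewrite normc_def ltcR ltr_sqrt /= subr0 opprK.
      have -> : (b + k * b) ^+ 2 = b ^+ 2 + M ^+ 2 + (k * b) ^+ 2 by rewrite -kb; ring.
      have := sqr_ge0 a; lra.
    rewrite ltr_wpDl ?sqr_ge0 // exprn_even_gt0 //=.
    have k0 : 0 <= k by rewrite divr_ge0 ?sqr_ge0 // mulr_ge0 // ltW.
    by rewrite -[X in X + _]mul1r -mulrDl mulf_neq0 // lt0r_neq0 // ltr_pwDl.
pose a := complex.Re z0.
have z0E : z0 = toC a by move: b0; rewrite /a; case: (z0) => u v /= ->.
have Da : ~ D a by move=> Da; apply: nz0; exists a.
have [d d0 dD] : exists2 d : R, 0 < d & forall x, D x -> d <= `|a - x|.
  have : \forall y \near a, (~` D) y
    by apply: open_nbhs_nbhs; split => //; exact: closed_openC.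
  move=> /nbhs_ballP [d /= d0 h]; exists d => // x Dx.
  by rewrite leNgt; apply/negP => xd; apply: (h x xd).
(* The cap at 1 keeps the radii chosen below nonnegative. *)
pose d' := Num.min d 1.
have d'0 : 0 < d' by rewrite lt_min d0 ltr01.
have d'1 : d' <= 1 by rewrite ge_min lexx orbT.
have d'd : d' <= d by rewrite ge_min lexx.
pose M' := M + `|a| + 1.
have aM := ler_norm a; have aM' := ler_norm (- a); rewrite normrN in aM'.
(* Points of [D] on both sides would force [a] into [D], since [D] is an interval. *)
have side : (forall x, D x -> x <= a - d') \/ (forall x, D x -> a + d' <= x).
  have far x : D x -> x <= a - d' \/ a + d' <= x.
    move=> /dD; have [ax|xa] := leP x a; [rewrite ger0_norm|rewrite ltr0_norm];
      rewrite ?subr_ge0 ?subr_lt0 // => ?; [left|right]; lra.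
  have [[y [Dy ay]]|no] := pselect (exists y, D y /\ a + d' <= y); last first.
    by left => x Dx; have [//|ax] := far x Dx; case: no; exists x.
  right => x Dx; have [xa|//] := far x Dx.
  case: Da; apply: (iD x y) => //; apply/andP; split; lra.
have M'p : 1 + `|a| <= M' by rewrite /M'; lra.
case: side => side.
- exists (toC (- M')), (a + M' - d'); split.
  + lra.
  + move=> x Dx; have := DM x Dx; rewrite ler_norml => /andP [Mx _].
    have sx := side x Dx.
    rewrite -rmorphB norm_real_complex lecR opprK ger0_norm; last by rewrite /M'; lra.
    lra.
  + by rewrite z0E -rmorphB norm_real_complex ltcR opprK ger0_norm; lra.
- exists (toC M'), (M' - a - d'); split.
  + lra.
  + move=> x Dx; have := DM x Dx; rewrite ler_norml => /andP [_ Mx].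
    have sx := side x Dx.
    rewrite -rmorphB norm_real_complex lecR distrC ger0_norm; last by rewrite /M'; lra.
    lra.
  + by rewrite z0E -rmorphB norm_real_complex ltcR distrC ger0_norm; lra.
Qed.

Lemma near_outside_disc c (r1 : R) (z0 : R[i]^o) : toC r1 < `|z0 - c| ->
  \forall z \near z0, toC r1 <= `|(z : R[i]) - c|.
Proof.
move=> h; apply/nbhs_ballP; exists (`|z0 - c| - toC r1); first by rewrite /= subr_gt0.
move=> z /=; rewrite /ball /= => hz.
have zc : `|z0 - c| <= `|z0 - z| + `|(z : R[i]) - c|.
  by apply: le_trans (ler_normD _ _); rewrite addrA subrK.
have : toC r1 + `|z0 - z| < `|z0 - z| + `|(z : R[i]) - c|.
  by apply: lt_le_trans zc; rewrite addrC -ltrBrDr.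
by rewrite addrC ltrD2l => /ltW.
Qed.

Lemma real_complex_continuous : continuous (real_complex R : R -> R[i]^o).
Proof.
move=> x; apply/cvg_ballP => e /complex_gt0E [r r0 ->].
near=> y; rewrite /ball /= -rmorphB norm_real_complex ltcR.
by near: y; exact: (nbhsx_ballx x r r0).
Unshelve. all: by end_near. Qed.

Lemma compact_square (r : R) : compact [set z : R[i]^o |
  `|complex.Re z| <= r /\ `|complex.Im z| <= r].
Proof.
pose f (p : R * R) : R[i]^o := real_complex R p.1 + Complex 0 1 * real_complex R p.2.
have -> : [set z : R[i]^o | `|complex.Re z| <= r /\ `|complex.Im z| <= r] =
   f @` (`[- r, r]%classic `*` `[- r, r]%classic).
  apply/seteqP; split => [z [hr hi]|_ [[x y] [/= hx hy] <-]].
    exists (complex.Re z, complex.Im z); last by rewrite /f /= [RHS]complexE.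
    by split; rewrite /= in_itv /= -ler_norml.
  by move: hx hy; rewrite !in_itv /= -!ler_norml /f; simpc.
apply: continuous_compact; last by apply: compact_setX; exact: segment_compact.
apply: continuous_subspaceT => p.
apply: (@continuousD _ _ _ (fun p : R * R => real_complex R p.1 : R[i]^o)
   (fun p : R * R => Complex 0 1 * real_complex R p.2 : R[i]^o)).
  apply: (@continuous_comp _ _ _ fst (real_complex R : R -> R[i]^o)).
    exact: cvg_fst.
  exact: real_complex_continuous.
apply: (@continuousM _ _ (fun=> Complex 0 1 : R[i]^o)); first exact: cst_continuous.
apply: (@continuous_comp _ _ _ snd (real_complex R : R -> R[i]^o)).
  exact: cvg_snd.
exact: real_complex_continuous.
Qed.

(** The complement of a compact square is a neighbourhood of infinity, and a point of modulus below
    [r] lies in the square of half-side [r]. *)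
Lemma sphere_nbhs_infty (r : R) : nbhs (None : sphere R)
  [set z : sphere R | if z is Some w then toC r <= `|(w : R[i])| else True].
Proof.
exists [set z : R[i]^o | `|complex.Re z| <= r /\ `|complex.Im z| <= r].
  split; first exact: compact_square.
  apply: compact_closed; last exact: compact_square.
  exact: norm_hausdorff.
move=> [z|] // [[w nw [<-]]|//].
rewrite /= real_leNgt ?normr_real ?complex_real //; apply/negP => /ltW wr; apply: nw.
by split; [exact: normc_Re_le|exact: normc_Im_le].
Qed.

Lemma sphere_nbhs_Some (z0 : R[i]^o) (P : R[i] -> Prop) :
  (\forall z \near z0, P z) ->
  nbhs (Some z0 : sphere R) [set z : sphere R | if z is Some w then P w else True].
Proof. by []. Qed.

(** The bound tends to 0 as [r1] grows, so [f] vanishes at infinity. *)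
Lemma sphere_ext_infty (f : R[i] -> 'M[R[i]]_(2, 3)) (c : R[i]) (K r0 : R) :
  0 <= K ->
  (forall (r1 : R) z, r0 < r1 -> toC r1 <= `|z - c| ->
     forall b a, `|f z b a| <= toC (K * (r1 - r0)^-1)) ->
  sphere_ext f (None : sphere R) = 0.
Proof.
move=> K0 fK; rewrite /sphere_ext; apply: cvg_lim; first exact: norm_hausdorff.
apply/cvg_ballP => e e0; have [r r_gt0 rE] := complex_gt0E e0.
have [rc rc0 rcE] := norm_complexE c.
(* Chosen so that [r1] is positive and r1 - r0 exceeds K/r. *)
pose r1 := `|r0| + K / r + 1.
have Kr0 : 0 <= K / r by rewrite divr_ge0 // ltW.
have r01 : r0 < r1 by have := ler_norm r0; rewrite /r1; lra.
have Klt : K * (r1 - r0)^-1 < r.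
  rewrite ltr_pdivrMr ?subr_gt0 //.
  have : K / r < r1 - r0 by have := ler_norm r0; rewrite /r1; lra.
  by rewrite ltr_pdivrMr // mulrC.
(* For |w| < d the inverse of [w] has modulus above r1 + |c|, hence lies outside the disc of radius
   [r1] about [c]. *)
pose d := (r1 + rc)^-1.
have r1_gt0 : 0 < r1 by have := normr_ge0 r0; rewrite /r1; lra.
have d0 : 0 < d by rewrite invr_gt0 ltr_wpDr.
have nw : \forall w \near (0 : R[i]^o)^', w != 0 /\ `|w : R[i]| < toC d.
  rewrite /dnbhs /within /=; apply/nbhs_ballP; exists (toC d); first by rewrite /= ltcR.
  by move=> w; rewrite /ball /= sub0r normrN.
apply: filterS nw => w [w0 wd].
split => // b a; rewrite /ball /= mxE sub0r normrN rE.
apply: le_lt_trans (fK r1 _ r01 _ b a) _; last by rewrite ltcR.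
have wn0 : 0 < `|w : R[i]| by rewrite normr_gt0.
have h : toC (r1 + rc) <= `|w^-1 : R[i]|.
  rewrite normfV -[toC _]invrK -fmorphV lef_pV2 ?posrE ?ltW //.
  by rewrite ltcR.
have : `|w^-1 : R[i]| <= `|w^-1 - c| + `|c|.
  by apply: le_trans (ler_normD _ _); rewrite subrK.
rewrite rcE -lerBlDr; apply: le_trans.
by rewrite lerBrDr -rmorphD.
Qed.

End Sphere.

(** * From local estimates to uniform convergence on the sphere *)

(** Compactness in its near-covering form glues the local estimates. At infinity the extensions
    agree once [N0 <= N], so the local estimates need only concern finite points. *)
Lemma cvg_compacts_local (R : realType) (D : set R)
    (f : nat -> R[i] -> 'M[R[i]]_(2, 3)) (g : R[i] -> 'M[R[i]]_(2, 3)) (N0 : nat) :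
  sphere_ext g (None : sphere R) = 0 ->
  (forall N, (N0 <= N)%N -> sphere_ext (f N) (None : sphere R) = 0) ->
  (forall z0 : sphere R, ~ (@sphere_embed R @` D) z0 -> forall e : R, 0 < e ->
     exists2 U : set (sphere R), nbhs z0 U & exists N1, forall N, (N1 <= N)%N ->
     forall z : R[i], U (Some z) -> forall b a, `|f N z b a - g z b a| < real_complex R e) ->
  cvg_compacts D f g.
Proof.
move=> g0 f0 fg K cK KD; move=> A /uniform_nbhs [E [entE EA]].
move: entE; rewrite -entourage_from_ballE => -[e /= /complex_gt0E [r r0 ->] rE].
suff : \forall N \near \oo, K `<=`
    [set z | ball (sphere_ext g z) (real_complex R r) (sphere_ext (f N) z)].
  by apply: filterS => N h; apply: EA => z Kz; apply: rE; exact: h.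
move/compact_near_coveringP : cK; apply => z0 Kz0.
have nz0 : ~ (@sphere_embed R @` D) z0.
  by move=> h; have : (K `&` (@sphere_embed R @` D)) z0 by []; rewrite KD.
have [U nU [N1 hN]] := fg z0 nz0 r r0.
exists (U, [set N | (maxn N0 N1 <= N)%N]).
  by split => //; exact: nbhs_infty_ge.
move=> [z N] /= [UZ]; rewrite geq_max => /andP [NN0 NN1].
case: z UZ => [z|] UZ.
  split; first by rewrite ltcR.
  by move=> b a; rewrite /ball /= distrC; exact: hN.
by rewrite g0 f0 //; apply: ballxx; rewrite ltcR.
Qed.

Theorem theorem4p2 (R : realType) (T : imatrix R)
    (nu11 nu12 nu22 xi11 : R)
    (psi : 'I_2 -> 'I_3 -> {charge set R -> \bar R})
    (T_banded : banded T)
    (T_extreme : forall n : nat, T (n + 3)%N n * T n (n + 2)%N != 0)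
    (T_bounded : bounded_operator T)
    (T_PBF : exists s : R, 0 <= s /\ has_PBF (iaddmx T (iscalar_mx s)))
    (psi_spectral :
       spectral_matrix T (nu_mx nu11 nu12 nu22) (xi_mx xi11) psi) :
  cvg_compacts (Delta T)
    (S_ T (nu_mx nu11 nu12 nu22) (xi_mx xi11)) (psi_hat T psi) /\
  cvg_compacts (Delta T)
    (P1_div_P T (nu_mx nu11 nu12 nu22) (xi_mx xi11)) (psi_hat T psi).
Proof.
have [M M0 DM] := Delta_bounded T_bounded.
have est := weyl_estimate T_banded T_bounded T_PBF psi_spectral.
have disc0 x : Delta T x -> `|real_complex R x - 0| <= real_complex R M.
  by move=> /DM; rewrite subr0 norm_real_complex lecR.
(* A disc about the origin containing Delta controls the values at infinity. *)
have [K0 K00 est0] := est 0 M M0 disc0.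
(* Every point of the sphere off Delta has a neighbourhood whose finite points lie outside a disc
   strictly larger than, and concentric with, one containing Delta. *)
have cover (z0 : sphere R) : ~ (@sphere_embed R @` Delta T) z0 ->
    exists c r0 r1, [/\ 0 <= r0, r0 < r1,
      forall x, Delta T x -> `|real_complex R x - c| <= real_complex R r0 &
      nbhs z0 [set z : sphere R | if z is Some w
         then real_complex R r1 <= `|(w : R[i]) - c| else True]].
  case: z0 => [z0|] nz0.
    have nDz : ~ (exists2 x, Delta T x & z0 = real_complex R x).
      by move=> [x Dx e]; apply: nz0; exists x => //; rewrite e.
    have [c [r0 [r1 [r00 r01 Dc zc]]]] := separating_disc (@closed_Delta _ T)
      (@is_interval_Delta _ T) M0 DM nDz.
    exists c, r0, r1; split => //; apply: sphere_nbhs_Some.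
    exact: near_outside_disc.
  exists 0, M, (M + 1); split => //; first by rewrite ltrDl.
  by have := sphere_nbhs_infty (M + 1); apply: filterS => -[z|] //=; rewrite subr0.
have small (z0 : sphere R) (e : R) : 0 < e -> ~ (@sphere_embed R @` Delta T) z0 ->
    exists2 U : set (sphere R), nbhs z0 U & exists N1, forall N, (N1 <= N)%N ->
    forall z : R[i], U (Some z) ->
    P1_div_P T (nu_mx nu11 nu12 nu22) (xi_mx xi11) N z =
      S_ T (nu_mx nu11 nu12 nu22) (xi_mx xi11) N z /\
    forall b a, `|S_ T (nu_mx nu11 nu12 nu22) (xi_mx xi11) N z b a -
      psi_hat T psi z b a| < real_complex R e.
  move=> e0 /cover [c [r0 [r1 [r00 r01 Dc nU]]]].
  have [K K_ge0 hK] := est c r0 r00 Dc.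
  exists [set z : sphere R | if z is Some w
         then real_complex R r1 <= `|(w : R[i]) - c| else True] => //.
  have r1_gt0 : 0 < r1 by apply: le_lt_trans r01.
  have q1 : `|r0 / r1| < 1.
    by rewrite ger0_norm ?divr_ge0 ?(ltW r1_gt0) // ltr_pdivrMr // mul1r.
  (* The added 1 keeps the denominator positive even when [K] is 0. *)
  have Kd0 : 0 < e / (K * (r1 - r0)^-1 + 1).
    by rewrite divr_gt0 // ltr_wpDl // mulr_ge0 // invr_ge0 subr_ge0 ltW.
  have [n _ /(_ n (leqnn n)) qn] := cvg_expr q1 (nbhsx_ballx 0 _ Kd0).
  (* [n] is fixed by the ratio r0/r1 and [e] alone; from this truncation on all moments of order
     below [n] agree. *)
  exists (2 * n + 2)%N => N nN z zU.
  have N2 : (2 <= N)%N by rewrite (leq_trans _ nN) // leq_addl.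
  split; first by have [_ /(_ N N2) []] := hK r1 z r01 zU ord0 ord0.
  move=> b a; have [_ /(_ N N2) [_ _ /(_ n nN) h]] := hK r1 z r01 zU b a.
  apply: le_lt_trans h _; rewrite ltcR mulrCA.
  move: qn; rewrite /ball /= sub0r normrN ger0_norm ?exprn_ge0 ?divr_ge0 ?(ltW r1_gt0) //.
  have d0 : 0 <= K * (r1 - r0)^-1 by rewrite mulr_ge0 // invr_ge0 subr_ge0 ltW.
  rewrite ltr_pdivlMr; last by rewrite ltr_wpDl.
  apply: le_lt_trans; rewrite ler_wpM2l ?exprn_ge0 ?divr_ge0 ?(ltW r1_gt0) //.
  by rewrite lerDl.
have psi0 : sphere_ext (psi_hat T psi) (None : sphere R) = 0.
  apply: (@sphere_ext_infty _ _ 0 K0 M) => // r1 z r01 zr b a.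
  by have [] := est0 r1 z r01 zr b a.
have S0 N : (2 <= N)%N ->
    sphere_ext (S_ T (nu_mx nu11 nu12 nu22) (xi_mx xi11) N) (None : sphere R) = 0.
  move=> N2; apply: (@sphere_ext_infty _ _ 0 K0 M) => // r1 z r01 zr b a.
  by have [_ /(_ N N2) []] := est0 r1 z r01 zr b a.
have P0 N : (2 <= N)%N ->
    sphere_ext (P1_div_P T (nu_mx nu11 nu12 nu22) (xi_mx xi11) N) (None : sphere R) = 0.
  move=> N2; apply: (@sphere_ext_infty _ _ 0 K0 M) => // r1 z r01 zr b a.
  by have [_ /(_ N N2) [-> ? _]] := est0 r1 z r01 zr b a.
split; apply: (@cvg_compacts_local _ _ _ _ 2) => // z0 nz0 e e0;
  have [U nU [N1 hN]] := small z0 e e0 nz0; exists U => //; exists N1 => N NN1 z Uz b a.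
  by have [_] := hN N NN1 z Uz.
by have [-> ] := hN N NN1 z Uz.
Qed.
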